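(* For every positive integer $k$ there exist constants $C>0$ and $A>0$ (depending only on $k$) such that the following holds for all sufficiently large $n$ and every positive integer $l$. \begin{enumerate} \item[(i)] If $k$ is even, then every $k$-uniform hypergraph on $n$ vertices with at least $C\, n\,(n/l)^{k/2-1}\log n$ edges contains an even cover of size at most $A\, l\log n$. \item[(ii)] If $k$ is odd and $l\le n/\log^2 n$, then every $k$-uniform hypergraph on $n$ vertices with at least $C\, n\,(n/l)^{k/2-1}(\log n)^{\frac{1}{k+1}}$ edges contains an even cover of size at most $A\, l\log n$. \end{enumerate}
   Context: All logarithms are base 2. A $k$-uniform hypergraph on vertex set $V$ is a set of $k$-element subsets (edges) of $V$. A set $S$ of edges of a hypergraph is an even cover if every vertex belongs to an even number of edges of $S$, i.e. $\bigoplus_{E\in S}E=\emptyset$ (equivalently, the characteristic vectors of the edges in $S$ sum to $0$ over $\mathbb{F}_2$). The size of an even cover is the number of edges in it. The statement ''size $O(l\log n)$'' in the paper is expressed here via the constant $A$.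
   Formalization: Even covers are required to be nonempty; part (i) assumes in addition l ≤ n (for even k ≥ 4 and very large l the edge threshold drops below 1 and the claim fails), and part (ii) assumes k ≥ 3 (for k = 1 distinct singletons never form a nonempty even cover). *)

(* Defs.v *)
From mathcomp Require Export all_boot all_order all_algebra.
From mathcomp Require Export reals exp.

Set Implicit Arguments.
Unset Strict Implicit.
Unset Printing Implicit Defensive.

Import Order.TTheory GRing.Theory Num.Theory.
Local Open Scope ring_scope.

Definition log2 (R : realType) (x : R) : R := ln x / ln 2.

Definition uniform_hypergraph (V : finType) (k : nat) (H : {set {set V}}) : Prop :=
  forall E : {set V}, E \in H -> #|E| = k.

(* Nonemptiness is part of the notion: otherwise set0 would be an even cover
   of every hypergraph. *)
Definition even_cover (V : finType) (H S : {set {set V}}) : Prop :=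
  [/\ S \subset H, S != set0
    & forall v : V, ~~ odd #|[set E in S | v \in E]|].

(* Main.v *)
Require Import Defs.
From mathcomp Require Import all_boot all_order all_algebra.
From mathcomp Require Import reals exp.
From mathcomp Require Import zify lra ring.
From HB Require Import structures.

(** Consider a graph whose vertices carry subsets of [V] as labels, and in which each
edge is a small set of hyperedges whose sum over F_2 is the difference of the labels
of its end points.  Assume that every such set contains exactly one hyperedge of a
fixed set H0, its center, and that the edges with a given center form a matching.  If
the graph has N vertices and average degree at least 4t with 2^t > N, then t-step walks
in a subgraph of minimum degree 2t realise at least binomial(2t, t) > N sets of t
distinct centers, so two walks with different center sets end at the same vertex, and
the sum of all hyperedges used is a nonempty even cover of size O(t).

For even k the graph is the Kikuchi graph on l-subsets of V (up to a constant factor in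
the size), where S is joined to S + E when E is split evenly by S.

For k = 2r+1, call a j-set heavy if it has degree more than 2(n/l)^(r+1-j), the exponent
being truncated at 0.  Either a constant proportion of the hyperedges can be grouped
into buckets of hyperedges through a common heavy j-set, and a center is then combined
with one leaf of its bucket; or, after deleting few hyperedges, there is no heavy set,
and a center is combined with k leaves, one through each of its vertices.  The absence
of larger heavy sets bounds a second moment, which produces the matchings.  Only
centers have to be distinct: leaves come from a disjoint part of the hypergraph, and
may repeat or cancel.  With m hyperedges, the two average degrees are of order
m (l/n)^r and m (m/n)^k (l/n)^(rk), and both exceed l log n under the hypothesis. *)

Set Implicit Arguments.
Unset Strict Implicit.
Unset Printing Implicit Defensive.

(** * Symmetric differences and boundaries *)

Section SymmetricDifference.
Variable T : finType.
Implicit Types A B C : {set T}.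

Definition sdiff A B := [set x | (x \in A) (+) (x \in B)].

Lemma in_sdiff A B x : (x \in sdiff A B) = (x \in A) (+) (x \in B).
Proof. by rewrite inE. Qed.

Lemma sdiffA : associative sdiff.
Proof. by move=> A B C; apply/setP=> x; rewrite !in_sdiff addbA. Qed.

Lemma sdiffC : commutative sdiff.
Proof. by move=> A B; apply/setP=> x; rewrite !in_sdiff addbC. Qed.

Lemma sdiff0s : left_id set0 sdiff.
Proof. by move=> A; apply/setP=> x; rewrite !in_sdiff in_set0. Qed.

Lemma sdiffs0 : right_id set0 sdiff.
Proof. by move=> A; rewrite sdiffC sdiff0s. Qed.

Lemma sdiffss A : sdiff A A = set0.
Proof. by apply/setP=> x; rewrite !in_sdiff in_set0 addbb. Qed.

Lemma sdiffK A B : sdiff (sdiff A B) B = A.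
Proof. by rewrite -sdiffA sdiffss sdiffs0. Qed.

Lemma sdiffKl A B : sdiff A (sdiff A B) = B.
Proof. by rewrite sdiffA sdiffss sdiff0s. Qed.

Lemma sdiffI A B : sdiff A B = set0 -> A = B.
Proof. by move=> AB0; rewrite -[A](sdiffK _ B) AB0 sdiff0s. Qed.

Lemma card_sdiff A B : #|sdiff A B| + (#|A :&: B|).*2 = #|A| + #|B|.
Proof.
have -> : sdiff A B = (A :\: B) :|: (B :\: A).
  by apply/setP=> x; rewrite !inE; case: (x \in A); case: (x \in B).
have d0 : (A :\: B) :&: (B :\: A) = set0.
  by apply/setP=> x; rewrite !inE; case: (x \in A); case: (x \in B).
rewrite cardsU d0 cards0 subn0 -(cardsID B A) -(cardsID A B) (setIC B A) -addnn.
by lia.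
Qed.

Lemma odd_card_sdiff A B : odd #|sdiff A B| = odd #|A| (+) odd #|B|.
Proof. by rewrite -oddD -card_sdiff oddD odd_double addbF. Qed.

Lemma card_sdiff_le A B : #|sdiff A B| <= #|A| + #|B|.
Proof. by rewrite -card_sdiff leq_addr. Qed.

Lemma sdiff_subset A B C : A \subset C -> B \subset C -> sdiff A B \subset C.
Proof.
move=> /subsetP AC /subsetP BC; apply/subsetP=> x; rewrite in_sdiff.
by case: (boolP (x \in A)) => [/AC //|_] /= /BC.
Qed.

Lemma sdiffIl A B C : sdiff A B :&: C = sdiff (A :&: C) (B :&: C).
Proof.
by apply/setP=> x; rewrite !inE; case: (x \in A); case: (x \in B); case: (x \in C).
Qed.

HB.instance Definition _ :=
  Monoid.isComLaw.Build {set T} set0 sdiff sdiffA sdiffC sdiff0s.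

End SymmetricDifference.

Section Boundary.
Variable V : finType.
Implicit Types (X Y H : {set {set V}}) (E : {set V}).

Definition boundary X : {set V} := [set v | odd #|[set E in X | v \in E]|].

Lemma boundary_sdiff : {morph boundary : X Y / sdiff X Y >-> sdiff X Y}.
Proof.
move=> X Y; apply/setP=> v; rewrite in_sdiff !inE -odd_card_sdiff.
by congr odd; apply: eq_card => E; rewrite !inE; case: (v \in E); rewrite ?andbT ?andbF.
Qed.

Lemma boundary0 : boundary set0 = set0.
Proof.
apply/setP=> v; rewrite !inE (_ : [set E in _ | _] = set0) ?cards0 //.
by apply/setP=> E; rewrite !inE.
Qed.

Lemma boundary1 E : boundary [set E] = E.
Proof.
apply/setP=> v; rewrite !inE; case: (boolP (v \in E)) => vE.
  rewrite (_ : [set F in _ | _] = [set E]) ?cards1 //.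
  by apply/setP=> F; rewrite !inE; case: eqP => // ->.
rewrite (_ : [set F in _ | _] = set0) ?cards0 //.
by apply/setP=> F; rewrite !inE; case: eqP => // ->; rewrite (negbTE vE).
Qed.

Lemma boundary_even_cover H X :
  X \subset H -> X != set0 -> boundary X = set0 -> even_cover H X.
Proof. by move=> XH X0 /setP bX; split=> // v; have := bX v; rewrite !inE => ->. Qed.

End Boundary.

(** * Even covers from walks in an edge-labelled graph *)

Section Walk.
Variables (V W : finType) (H H0 : {set {set V}}) (phi : W -> {set V}).
Variables (D : {set W}) (R : {set V} -> rel W) (p t : nat).
Hypothesis R_sym : forall E, symmetric (R E).
Hypothesis R_fun : forall E w x y, R E w x -> R E w y -> x = y.
Hypothesis R_dom : forall E w x, R E w x -> w \in D.
Hypothesis R_label : forall E w x, E \in H0 -> R E w x ->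
  exists L : {set {set V}}, [/\ L \subset H, #|L| <= p, L :&: H0 = [set E]
    & boundary L = sdiff (phi w) (phi x)].

Let edges (B : {set W}) : {set {set V} * (W * W)} :=
  [set z | [&& z.1 \in H0, R z.1 z.2.1 z.2.2, z.2.1 \in B & z.2.2 \in B]].
Let centers (B : {set W}) (w : W) : {set {set V}} :=
  [set E in H0 | [exists x, R E w x && (x \in B)]].

(** Edges are counted with orientation. As [R E] is a symmetric partial function, a center at [w]
    accounts for at most one edge leaving [w] and one entering it. *)
Lemma card_edges_rem (B : {set W}) (w : W) :
  w \in B -> #|edges B| <= #|edges (B :\ w)| + (#|centers B w|).*2.
Proof.
move=> wB.
pose L := [set z in edges B | z.2.1 == w]; pose Q := [set z in edges B | z.2.2 == w].
have sub : edges B \subset edges (B :\ w) :|: (L :|: Q).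
  apply/subsetP=> z; rewrite !inE => /and4P[-> -> -> ->] /=.
  by case: eqP => //=; case: eqP.
have cL : #|L| <= #|centers B w|.
  rewrite -(@card_in_imset _ _ fst L) => [|z z'].
    apply: subset_leq_card; apply/subsetP=> E /imsetP[z]; rewrite !inE.
    move=> /andP[/and4P[zH zR _ zB] /eqP zw] ->; rewrite zH /=.
    by apply/existsP; exists z.2.2; rewrite -zw zR zB.
  case: z z' => [E [x y]] [E' [x' y']]; rewrite !inE /=.
  move=> /andP[/and4P[_ zR _ _] /eqP zw] /andP[/and4P[_ zR' _ _] /eqP zw'] eE.
  by move: zR zR'; rewrite eE zw zw' => zR /(R_fun zR) ->.
have cQ : #|Q| <= #|centers B w|.
  rewrite -(@card_in_imset _ _ fst Q) => [|z z'].
    apply: subset_leq_card; apply/subsetP=> E /imsetP[z]; rewrite !inE.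
    move=> /andP[/and4P[zH zR zB _] /eqP zw] ->; rewrite zH /=.
    by apply/existsP; exists z.2.1; rewrite -zw R_sym zR zB.
  case: z z' => [E [x y]] [E' [x' y']]; rewrite !inE /=.
  move=> /andP[/and4P[_ zR _ _] /eqP zw] /andP[/and4P[_ zR' _ _] /eqP zw'] eE.
  by move: zR zR'; rewrite eE zw zw' R_sym => zR; rewrite R_sym => /(R_fun zR) ->.
have h1 := subset_leq_card sub.
have h2 := (leq_card_setU (edges (B :\ w)) (L :|: Q)).1.
have h3 := (leq_card_setU L Q).1.
by lia.
Qed.

(** Vertices with fewer than [2t] centers are deleted one at a time: each deletion costs fewer than
    [4t] oriented edges, so the density survives, and with it nonemptiness. *)
Lemma min_degree_subset (B : {set W}) : 0 < t -> B != set0 ->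
  4 * t * #|B| <= #|edges B| ->
  exists2 B' : {set W}, B' != set0 &
    forall w, w \in B' -> t.*2 <= #|centers B' w|.
Proof.
move=> t_gt0; have [m] := ubnP #|B|; elim: m B => // m IH B Bm B0 Be.
have [/forallP good|] := boolP [forall w, (w \in B) ==> (t.*2 <= #|centers B w|)].
  by exists B => // w wB; have := good w; rewrite wB.
rewrite negb_forall => /existsP[w]; rewrite negb_imply -ltnNge => /andP[wB cw].
have rem := card_edges_rem wB.
have cB : #|B| = (#|B :\ w|).+1 by rewrite (cardsD1 w B) wB.
apply: (IH (B :\ w)); first by lia.
  apply: contraTneq Be => B1; rewrite B1 cards0 in cB.
  suff e0 : #|edges (B :\ w)| = 0 by lia.
  by apply: eq_card0 => z; rewrite B1 !inE !andbF.
by move: Be; rewrite cB mulnS; lia.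
Qed.

Lemma central_bin_ge (s : nat) : 2 ^ s <= 'C(s.*2, s).
Proof.
elim: s => [|s IH]; first by rewrite bin0.
rewrite expnS doubleS binS.
have e : 'C(s.*2.+1, s.+1) = 'C(s.*2.+1, s).
  by rewrite -[in LHS](@bin_sub s.*2.+1 s.+1) ?subSS; [congr 'C(_, _); lia|lia].
have : 'C(s.*2, s) <= 'C(s.*2.+1, s) by apply: leq_bin2l; lia.
by rewrite e; lia.
Qed.

(* Only the set of centers used by a walk has to be tracked: since leaves lie
   outside of H0, they may repeat or cancel, and the trace on H0 of the sum of
   the labels still is the set of centers. *)
Lemma walk_even_cover : 0 < t -> D != set0 -> #|D| < 2 ^ t ->
  4 * t * #|D| <= \sum_(E in H0) #|[set u : W * W | R E u.1 u.2]| ->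
  exists2 S : {set {set V}}, even_cover H S & #|S| <= 2 * p * t.
Proof.
move=> t_gt0 D0 Dt De.
have eD : #|edges D| = \sum_(E in H0) #|[set u : W * W | R E u.1 u.2]|.
  rewrite -sum1_card (eq_bigl (fun z => (z.1 \in H0) && (R z.1 z.2.1 z.2.2))).
    rewrite -(pair_big_dep (fun E => E \in H0) (fun E u => R E u.1 u.2) (fun _ _ => 1)) /=.
    by apply: eq_bigr => E _; rewrite -sum1_card; apply: eq_bigl => u; rewrite inE.
  move=> z; rewrite inE; case: (z.1 \in H0) => //=.
  case: (boolP (R _ _ _)) => //= zR; rewrite (R_dom zR) /=.
  by move: zR; rewrite R_sym => /R_dom.
rewrite -eD in De.
have [B B0 Bdeg] := min_degree_subset t_gt0 D0 De.
have BD : B \subset D.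
  apply/subsetP=> w wB; have /card_gt0P[E] : 0 < #|centers B w|.
    by apply: leq_trans (Bdeg w wB); rewrite double_gt0.
  by rewrite inE => /andP[_ /existsP[x /andP[/R_dom]]].
have [w0 w0B] := set0Pn _ B0.
(* [X] stands for the sum over F_2 of the labels along a walk from [w0] to [w]; only its size, its
   boundary and its trace [Z] on [H0] are remembered. *)
pose ok s (Z : {set {set V}}) w (X : {set {set V}}) :=
  [&& w \in B, X \subset H, X :&: H0 == Z, #|X| <= p * s &
      boundary X == sdiff (phi w0) (phi w)].
pose reach s := [set Z : {set {set V}} |
  (#|Z| == s) && [exists w, exists X, ok s Z w X]].
(* Double counting of extensions by a new center: at least [2t - s] out of each set of [s] centers
   and at most [s + 1] into each larger set, which is the recursion of the binomial coefficients. *)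
have reach_ge s : s <= t.*2 -> 'C(t.*2, s) <= #|reach s|.
  elim: s => [|s IH] st.
    rewrite bin0 card_gt0; apply/set0Pn; exists set0; rewrite inE cards0 eqxx /=.
    apply/existsP; exists w0; apply/existsP; exists set0.
    by rewrite /ok w0B sub0set set0I eqxx cards0 boundary0 sdiffss eqxx.
  have {IH} := IH (ltnW st) => IH.
  pose inc := [set u : {set {set V}} * {set V} | [&& u.1 \in reach s, u.2 \notin u.1
                 & (u.2 |: u.1) \in reach s.+1]].
  have lo : #|reach s| * (t.*2 - s) <= #|inc|.
    rewrite -sum1_card big_distrl /=.
    rewrite -[#|inc|]sum1_card (eq_bigl (fun u => (u.1 \in reach s) &&
      ((u.2 \notin u.1) && (u.2 |: u.1 \in reach s.+1)))); last by move=> u; rewrite inE.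
    rewrite -(pair_big_dep (fun Z => Z \in reach s)
       (fun Z E => (E \notin Z) && (E |: Z \in reach s.+1)) (fun _ _ => 1)) /=.
    apply: leq_sum => Z; rewrite inE => /andP[/eqP cZ /existsP[w /existsP[X]]].
    move=> /and5P[wB XH /eqP XZ cX /eqP bX].
    rewrite mul1n sum1_card.
    have: t.*2 - s <= #|centers B w :\: Z|.
      have := Bdeg w wB; have := subset_leq_card (subsetIr (centers B w) Z).
      by rewrite -(cardsID Z (centers B w)); lia.
    move=> h; apply: leq_trans h _; apply: subset_leq_card.
    apply/subsetP=> E; rewrite !inE => /andP[EZ /andP[EH /existsP[x /andP[Rx xB]]]].
    rewrite unfold_in EZ /= inE cardsU1 EZ cZ eqxx /=.
    have [L [LH cL LE bL]] := R_label EH Rx.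
    apply/existsP; exists x; apply/existsP; exists (sdiff X L).
    rewrite /ok xB sdiff_subset //= sdiffIl XZ LE boundary_sdiff bX bL.
    apply/and3P; split.
    - apply/eqP/setP=> F; rewrite in_sdiff !inE.
      by case: (F =P E) => [->|_]; rewrite ?(negbTE EZ) ?addbF.
    - by apply: leq_trans (card_sdiff_le X L) _; rewrite mulnS addnC leq_add.
    - by rewrite -sdiffA sdiffKl.
  have hi : #|inc| <= #|reach s.+1| * s.+1.
    pose f (u : {set {set V}} * {set V}) := (u.2 |: u.1, u.2).
    rewrite -(@card_in_imset _ _ f inc) => [|[Z E] [Z' E']].
      pose tgt := [set u : {set {set V}} * {set V} | (u.1 \in reach s.+1) && (u.2 \in u.1)].
      apply: (@leq_trans #|tgt|).
        apply: subset_leq_card; apply/subsetP=> u /imsetP[v vi ->]; move: vi.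
        by rewrite [v \in _]inE => /and3P[_ _ h]; rewrite inE /= h setU11.
      rewrite -sum1_card (eq_bigl (fun u => (u.1 \in reach s.+1) && (u.2 \in u.1)));
        last by move=> u; rewrite inE.
      rewrite -(pair_big_dep (fun Z => Z \in reach s.+1) (fun Z E => E \in Z) (fun _ _ => 1)) /=.
      rewrite -[X in _ <= X * _]sum1_card big_distrl /=; apply: leq_sum => Z.
      by rewrite inE sum1_card => /andP[/eqP -> _]; rewrite mul1n.
    rewrite !inE /f /= => /and3P[_ EZ _] /and3P[_ EZ' _] [eU eE].
    rewrite -eE in eU EZ' *; congr pair.
    by rewrite -(setU1K EZ) eU setU1K.
  rewrite -(leq_pmul2r (ltn0Sn s)) [X in X <= _]mulnC mul_bin_left mulnC.
  by apply: leq_trans (leq_trans lo hi); rewrite leq_mul2r IH orbT.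
(* One end point is chosen for each set of [t] centers; there are more such sets than vertices, so
   two of them share it. *)
pose pick_w Z := odflt w0 [pick w | [exists X, ok t Z w X]].
have pickP Z : Z \in reach t -> exists X, ok t Z (pick_w Z) X.
  rewrite inE => /andP[_ /existsP ex]; rewrite /pick_w; case: pickP => [w /existsP //|no].
  by case: ex => w; rewrite no.
have : ~~ dinjectiveb pick_w (mem (reach t)).
  apply/negP => /dinjectiveP inj.
  have : #|reach t| <= #|D|.
    rewrite -(card_in_imset inj); apply: subset_leq_card; apply/subsetP=> w /imsetP[Z ZR ->].
    have [X /and5P[wB _ _ _ _]] := pickP Z ZR.
    by apply: (subsetP BD).
  apply/negP; rewrite -ltnNge; apply: leq_trans Dt _; apply: leq_trans (central_bin_ge t) _.
  by apply: reach_ge; rewrite -addnn leq_addr.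
case/dinjectivePn=> Z ZR [Z']; rewrite !inE => /andP[ZZ' ZR'] eqw.
have [X /and5P[_ XH /eqP XZ cX /eqP bX]] := pickP Z ZR.
have {}ZR' : Z' \in reach t by rewrite inE.
have [X' /and5P[_ XH' /eqP XZ' cX' /eqP bX']] := pickP Z' ZR'.
exists (sdiff X X').
  apply: boundary_even_cover; first exact: sdiff_subset.
  - by apply: contraNneq ZZ' => /sdiffI XX'; apply/eqP; congruence.
  - by rewrite boundary_sdiff bX bX' eqw sdiffss.
apply: leq_trans (card_sdiff_le X X') _.
by rewrite -mulnA mul2n -addnn leq_add.
Qed.

End Walk.

(** * Large matchings from second moments *)

Lemma card_le_fibers (T U : finType) (P : {set T}) (Q : {set U}) (f : T -> U) (m : nat) :
  (forall x, x \in P -> f x \in Q) ->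
  (forall y, y \in Q -> #|[set x in P | f x == y]| <= m) -> #|P| <= #|Q| * m.
Proof.
move=> PQ fm; rewrite -sum1_card (partition_big f (mem Q)) //= -sum_nat_const.
apply: leq_sum => y yQ; apply: leq_trans (fm y yQ).
by rewrite -sum1_card; apply/eq_leq/eq_bigl => x; rewrite inE.
Qed.

Section Matching.
Variables (X Y : finType).

Definition is_matching (M : {set X * Y}) : Prop :=
  forall u v, u \in M -> v \in M -> (u.1 == v.1) || (u.2 == v.2) -> u = v.

(** Markov's inequality for the number of edges that agree with a given one under [f]; the two
    projections as [f] treat the two sides of a bipartite graph. *)
Lemma heavy_edges (Z : finType) (f : X * Y -> Z) (G : {set X * Y}) (K : nat) :
  #|[set z : (X * Y) * (X * Y) | [&& z.1 \in G, z.2 \in G & f z.1 == f z.2]]|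
    <= K * #|G| ->
  4 * #|[set u in G | 4 * K < #|[set v in G | f u == f v]|]| <= #|G|.
Proof.
set B := [set u in G | _] => le_K.
suff : #|B| * (4 * K).+1 <= K * #|G| by case: (K) => [|K']; nia.
apply: leq_trans le_K; rewrite -sum_nat_const.
rewrite -sum1_card (eq_bigl (fun z => (z.1 \in G) && ((z.2 \in G) && (f z.1 == f z.2))));
  last by move=> z; rewrite inE.
rewrite -(pair_big_dep (fun u => u \in G) (fun u v => (v \in G) && (f u == f v))
  (fun _ _ => 1)) /=.
rewrite [X in _ <= X](bigID (fun u => u \in B)) /=; apply: leq_trans (leq_addr _ _).
rewrite [X in X <= _](eq_bigl (fun u => (u \in G) && (u \in B))); last first.
  by move=> u; rewrite andbC; case: (boolP (u \in B)) => //; rewrite inE => /andP[->].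
apply: leq_sum => u /andP[_]; rewrite inE => /andP[_ h]; apply: leq_trans h _.
by rewrite -sum1_card; apply/eq_leq/eq_bigl => v; rewrite inE.
Qed.

(** Discarding the edges with more than [4K] neighbours on either side leaves at least half of [G].
    Every edge left meets a given maximal matching of the rest, and each matching edge meets at most
    [8K] edges. *)
Lemma exists_matching (G : {set X * Y}) (K : nat) :
  #|[set z : (X * Y) * (X * Y) | [&& z.1 \in G, z.2 \in G & z.1.1 == z.2.1]]|
    <= K * #|G| ->
  #|[set z : (X * Y) * (X * Y) | [&& z.1 \in G, z.2 \in G & z.1.2 == z.2.2]]|
    <= K * #|G| ->
  exists M : {set X * Y}, [/\ M \subset G, is_matching M & #|G| <= 16 * K * #|M|].
Proof.
move=> /heavy_edges hl /heavy_edges hr.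
set L := [set u in G | _] in hl; set R := [set u in G | _] in hr.
pose G' := G :\: (L :|: R).
have G'2 : #|G| <= 2 * #|G'|.
  have h1 := cardsID (L :|: R) G; rewrite -/G' in h1.
  have h2 := (leq_card_setU L R).1; have h3 := subset_leq_card (subsetIr G (L :|: R)).
  by clearbody G' L R; clear -hl hr h1 h2 h3; lia.
pose ok (M : {set X * Y}) := (M \subset G') &&
  [forall u in M, forall v in M, ((u.1 == v.1) || (u.2 == v.2)) ==> (u == v)].
have ok0 : ok set0.
  by rewrite /ok sub0set /=; apply/forall_inP => u; rewrite inE.
case: (@arg_maxnP _ set0 ok (fun M => #|M|) ok0) => M /andP[MG' /forall_inP MM] Mmax.
have MG : M \subset G by apply: subset_trans MG' (subsetDl _ _).
exists M; split => //.
  move=> u v uM vM uv; have /forall_inP/(_ v vM) := MM u uM.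
  by rewrite uv => /eqP.
pose nb (v : X * Y) := [set u in G | v.1 == u.1] :|: [set u in G | v.2 == u.2].
have cover_le : G' \subset \bigcup_(v in M) nb v.
  apply/subsetP=> u uG'; apply: contraT => uN.
  have uv v : v \in M -> ~~ ((v.1 == u.1) || (v.2 == u.2)).
    move=> vM; apply: contra uN => h; apply/bigcupP; exists v => //.
    by rewrite !inE -andb_orr h (subsetP (subsetDl _ _) _ uG').
  have uM : u \notin M by apply/negP => /uv; rewrite eqxx.
  have /Mmax : ok (u |: M).
    rewrite /ok subUset sub1set uG' MG' /=.
    apply/forall_inP => x; rewrite !inE => xM; apply/forall_inP => y; rewrite !inE => yM.
    apply/implyP; case/predU1P: xM => [->|xM]; case/predU1P: yM => [->|yM] //.
    - by rewrite [u.1 == _]eq_sym [u.2 == _]eq_sym; move/(negP (uv y yM)).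
    - by move/(negP (uv x xM)).
    - by have /forall_inP/(_ y yM)/implyP := MM x xM.
  by rewrite cardsU1 uM /= add1n ltnn.
have nbK v : v \in M -> #|nb v| <= 8 * K.
  move=> vM; have := subsetP MG' v vM; rewrite !inE negb_or => /andP[/andP[vL vR] vG].
  rewrite vG /= -leqNgt in vL; rewrite vG /= -leqNgt in vR.
  rewrite /nb (leq_trans (leq_card_setU _ _).1) //.
  by rewrite (_ : 8 * K = 4 * K + 4 * K) ?leq_add // -mulnDl.
have h : #|G'| <= #|M| * (8 * K).
  apply: leq_trans (subset_leq_card cover_le) _.
  rewrite -sum_nat_const; apply: leq_trans (leq_sum _ nbK).
  by elim/big_rec2: _ => [|v s T _ IH]; rewrite ?cards0 // (leq_trans (leq_card_setU _ _).1) ?leq_add2l.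
by clearbody G'; clear -G'2 h; lia.
Qed.

End Matching.

(** * Ratios of binomial coefficients under small shifts *)

Section Binomials.

Lemma bin_shift_step n m u : m <= n -> u < m ->
  'C(n - u.+1, m - u.+1) * n <= m * 'C(n - u, m - u).
Proof.
move=> mn um; have nu : 0 < n - u by lia.
have := mul_bin_diag (n - u) (m - u.+1); rewrite (_ : (n - u).-1 = n - u.+1); last by lia.
rewrite (_ : (m - u.+1).+1 = m - u); last by lia.
move=> e; rewrite -(leq_pmul2l nu) mulnA e.
have h : (m - u) * n <= m * (n - u) by nia.
by rewrite mulnAC [X in _ <= X]mulnA [(n - u) * m]mulnC leq_mul2r h orbT.
Qed.

(** Each further prescribed element of an [m]-set costs a factor at most [m / n]. *)
Lemma bin_shift n m u w : m <= n -> u + w <= m ->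
  'C(n - (u + w), m - (u + w)) * n ^ w <= m ^ w * 'C(n - u, m - u).
Proof.
move=> mn; elim: w => [|w IH] uw; first by rewrite addn0 !expn0 muln1 mul1n.
rewrite addnS expnS mulnA.
apply: (@leq_trans (m * 'C(n - (u + w), m - (u + w)) * n ^ w)).
  by rewrite leq_mul2r bin_shift_step ?orbT //; lia.
by rewrite -mulnA expnS -mulnA leq_mul2l IH ?orbT //; lia.
Qed.

(** While the ground set has at least [2z] elements, a given point lies in at most half of the
    [z]-sets, so removing it loses at most a factor 2. *)
Lemma bin_drop m z b : 2 * z + b <= m -> 'C(m, z) <= 2 ^ b * 'C(m - b, z).
Proof.
elim: b m => [|b IH] m h; first by rewrite subn0 mul1n.
case: m h => [|m] h; first by lia.
have step : 'C(m.+1, z) <= 2 * 'C(m, z).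
  have := mul_bin_down m.+1 z; rewrite /= => e.
  have m0 : 0 < m.+1 - z by lia.
  rewrite -(leq_pmul2l m0) -e mulnCA mulnA leq_mul2r; apply/orP; right; lia.
apply: leq_trans step _; rewrite expnS -mulnA leq_mul2l /= subSS IH //; lia.
Qed.

Lemma bin_lift n z a : z + a <= n ->
  'C(n, z + a) * z ^ a <= n ^ a * 'C(n - a, z).
Proof.
elim: a n => [|a IH] n h; first by rewrite addn0 subn0 muln1 mul1n.
case: n h => [|n] h; first by lia.
have e := mul_bin_diag n.+1 (z + a); rewrite /= in e.
rewrite addnS expnS mulnA.
apply: (@leq_trans (n.+1 * 'C(n, z + a) * z ^ a)).
  rewrite leq_mul2r e mulnC leq_mul2r; apply/orP; right; apply/orP; right; lia.
rewrite -mulnA expnS -mulnA leq_mul2l /= subSS.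
apply: leq_trans (IH n _) _; first by lia.
have le_exp : n ^ a <= n.+1 ^ a by case: (a) => // a'; rewrite leq_exp2r.
by rewrite leq_mul2r le_exp orbT.
Qed.

End Binomials.

Lemma exists_subset_card (T : finType) (B : {set T}) u :
  u <= #|B| -> exists2 A : {set T}, A \subset B & #|A| = u.
Proof.
rewrite -bin_gt0 -cards_draws => /card_gt0P[A]; rewrite inE => /andP[AB /eqP cA].
by exists A.
Qed.

(** * Matchings between two levels of the Kikuchi graph of a set family *)

Section LocalMatching.
Variable V : finType.
Implicit Types (S C Y : {set V}) (CC : {set {set V}}).

Lemma card_supersets (B : {set V}) m u : u <= #|B| -> u <= m ->
  #|[set S : {set V} | (#|S| == m) && (B \subset S)]| <= 'C(#|V| - u, m - u).
Proof.
move=> /exists_subset_card[A AB cA] um.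
have <- : #|~: A| = #|V| - u by have := cardsC A; lia.
rewrite -cards_draws -(@card_in_imset _ _ (fun S => S :\: A)) => [|S S'].
  apply: subset_leq_card; apply/subsetP=> x0 /imsetP[S]; rewrite inE => /andP[/eqP cS BS] ->.
  rewrite inE setDE subsetIr /= -setDE cardsD (setIidPr (subset_trans AB BS)) cS cA.
  by rewrite eqxx.
rewrite !inE => /andP[_ BS] /andP[_ BS'] eS.
rewrite -(setID S A) -(setID S' A) eS.
by rewrite (setIidPr (subset_trans AB BS)) (setIidPr (subset_trans AB BS')).
Qed.

(** The traces of [S] on [C] and [C'] take at most [4 ^ c] values, and [S] contains their union, of
    size at least [a + (a - #|C :&: C'|)]; the truncation covers intersections larger than [a]. *)
Lemma card_split_pair C C' c m a : #|C| = c -> #|C'| = c -> 2 * a <= m ->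
  #|[set S : {set V} | [&& #|S| == m, #|S :&: C| == a & #|S :&: C'| == a]]|
    <= 4 ^ c * 'C(#|V| - (a + (a - #|C :&: C'|)), m - (a + (a - #|C :&: C'|))).
Proof.
move=> cC cC' am.
have <- : #|setX (powerset C) (powerset C')| = 4 ^ c.
  by rewrite cardsX !card_powerset cC cC' -expnMn.
apply: (@card_le_fibers _ _ _ _ (fun S => (S :&: C, S :&: C'))) => [S _|[A A'] _].
  by rewrite inE /= !powersetE !subsetIr.
have [|F0] := boolP ((#|A| == a) && (#|A'| == a) && (A \subset C) && (A' \subset C')); last first.
  rewrite (_ : [set _ in _ | _] = set0) ?cards0 //; apply/setP=> S; rewrite !inE.
  apply: contraNF F0 => /andP[/and3P[_ aC aC'] /eqP[eA eA']].
  by rewrite -eA -eA' aC aC' !subsetIr.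
move=> /andP[/andP[/andP[/eqP cA /eqP cA'] AC] AC'].
apply: leq_trans (@card_supersets (A :|: A') m (a + (a - #|C :&: C'|)) _ _).
- apply: subset_leq_card; apply/subsetP=> S; rewrite !inE.
  move=> /andP[/and3P[-> _ _] /eqP[eA eA']] /=.
  by rewrite subUset -eA -eA' !subsetIl.
- have := subset_leq_card (setISS AC AC'); have := subset_leq_card (subsetIl A A').
  by have := cardsUI A A'; lia.
- by lia.
Qed.

Variables (k l z G : nat).
Hypothesis k_gt0 : 0 < k.
Hypothesis l_gt0 : 0 < l.
Hypothesis z_def : z = k * l.
Hypothesis V_large : 4 * k * l <= #|V|.

(** In fractional form, [Y] has codegree at most [G (n/l)^(a - #|Y|)], the exponent being truncated
    at 0. This balances the factor of order [(l/n)^(a - #|Y|)] paid when a set has to split a second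
    member that overlaps the first in [Y]. *)
Definition codegree_bounded (a : nat) CC := forall Y : {set V},
  #|[set C in CC | Y \subset C]| * l ^ (a - #|Y|) <= G * #|V| ^ (a - #|Y|).

Let K := 16 ^ k * ((2 * k) ^ k * G).

(** Triples are sorted by [Y = C :&: C']. With [w = a - #|Y|], the number of [C'] is at most of
    order [(n/l)^w], while the sets [S] split by both become rarer by [(l/n)^w], so each of the
    boundedly many [Y] contributes a constant factor. *)
Lemma second_moment (a b : nat) CC :
  a + b <= k -> (forall C, C \in CC -> #|C| = a + b) -> codegree_bounded a CC ->
  #|[set x : {set V} * ({set V} * {set V}) |
      [&& x.1 \in CC, x.2.1 \in CC, #|x.2.2| == z + a, #|x.2.2 :&: x.1| == a
        & #|x.2.2 :&: x.2.1| == a]]|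
    <= K * (#|CC| * 'C(#|V| - (a + b), z)).
Proof.
move=> abk CCc codeg; have nV := V_large; set n := #|V| in nV *; set c := a + b in CCc *.
have kl : k <= k * l by rewrite -[X in X <= _]muln1 leq_mul2l l_gt0 orbT.
have n_gt0 : 0 < n by lia.
pose pa := 'C(n - a, z).
have pa_le : pa <= 2 ^ k * 'C(n - c, z).
  apply: (@leq_trans (2 ^ b * 'C(n - a - b, z))); first by apply: bin_drop; lia.
  by rewrite subnDA leq_mul2r leq_exp2l //; apply/orP; right; lia.
have main C : C \in CC ->
  #|[set y : {set V} * {set V} | [&& y.1 \in CC, #|y.2| == z + a, #|y.2 :&: C| == a
        & #|y.2 :&: y.1| == a]]| <= 2 ^ c * (4 ^ c * ((2 * k) ^ k * G * pa)).
  move=> CCC; have cC := CCc C CCC.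
  have <- : #|powerset C| = 2 ^ c by rewrite card_powerset cC.
  apply: (@card_le_fibers _ _ _ _ (fun y => C :&: y.1)) => [y _|Y _].
    by rewrite powersetE subsetIl.
  pose w := a - #|Y|.
  apply: (@leq_trans (#|[set C' in CC | Y \subset C']| *
     (4 ^ c * 'C(n - (a + w), z + a - (a + w))))).
    apply: (@card_le_fibers _ _ _ _ fst) => [y|C'].
      by rewrite !inE => /andP[/and4P[-> _ _ _] /eqP <-]; rewrite subsetIr.
    rewrite inE => /andP[CC' _].
    have [CY|CY] := eqVneq (C :&: C') Y; last first.
      rewrite (_ : [set _ in _ | _] = set0) ?cards0 //; apply/setP=> y; rewrite !inE.
      apply: contraNF CY => /andP[/andP[_ eY] /eqP e1].
      by rewrite -e1.
    rewrite /w -CY; apply: leq_trans (card_split_pair cC (CCc C' CC') _); last by lia.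
    rewrite -(@card_in_imset _ _ snd) => [|[y1 y2] [y1' y2']].
      apply: subset_leq_card; apply/subsetP=> _ /imsetP[y yP ->]; move: yP; rewrite !inE.
      by move=> /andP[/andP[/and4P[_ -> -> h] _] /eqP <-].
    by rewrite !inE /= => /andP[_ /eqP ->] /andP[_ /eqP ->] ->.
  rewrite mulnCA leq_mul2l; apply/orP; right.
  have g0 := codeg Y; rewrite -/w -/n in g0; set g := #|[set C' in _ | _]| in g0 *.
  have h1 : 'C(n - (a + w), z + a - (a + w)) * n ^ w <= (2 * k * l) ^ w * pa.
    apply: (@leq_trans ((z + a) ^ w * pa)).
      have := @bin_shift n (z + a) a w; rewrite addnK; apply; lia.
    rewrite leq_mul2r; apply/orP; right.
    have [->|w0] := posnP w; first by rewrite !expn0.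
    by rewrite leq_exp2r //; lia.
  have w0 : 0 < l ^ w * n ^ w by rewrite muln_gt0 !expn_gt0 l_gt0 n_gt0.
  rewrite -(leq_pmul2r w0) mulnACA.
  apply: (leq_trans (leq_mul g0 h1)).
  rewrite expnMn.
  have kw : (2 * k) ^ w <= (2 * k) ^ k by rewrite leq_pexp2l //; lia.
  have -> : G * n ^ w * ((2 * k) ^ w * l ^ w * pa) =
            (2 * k) ^ w * (G * pa * (l ^ w * n ^ w)) by clear; lia.
  by rewrite -!mulnA leq_mul2r kw orbT.
apply: (@leq_trans (#|CC| * (2 ^ c * (4 ^ c * ((2 * k) ^ k * G * pa))))).
  apply: (@card_le_fibers _ _ _ _ fst) => [x|C CCC]; first by rewrite inE => /and5P[].
  apply: leq_trans (main C CCC).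
  rewrite -(@card_in_imset _ _ snd) => [|[x y] [x' y']].
    apply: subset_leq_card; apply/subsetP=> _ /imsetP[y yP ->]; move: yP; rewrite !inE.
    by move=> /andP[/and5P[_ -> -> h ->] /eqP <-]; rewrite h.
  by rewrite !inE /= => /andP[_ /eqP ->] /andP[_ /eqP ->] ->.
rewrite /K [X in _ <= X]mulnCA leq_mul2l; apply/orP; right.
rewrite mulnA -expnMn.
apply: (@leq_trans (8 ^ k * ((2 * k) ^ k * G * (2 ^ k * 'C(n - c, z))))).
  by rewrite leq_mul ?leq_mul // leq_exp2l.
have -> : 16 ^ k = 8 ^ k * 2 ^ k by rewrite -expnMn.
by clear; lia.
Qed.

(** A bipartite Kikuchi graph: two different levels allow members of odd size, which are split
    unevenly. *)
Definition local_edges (a : nat) CC : {set {set V} * {set V}} :=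
  [set u : {set V} * {set V} |
    [&& #|u.1| == z + a, sdiff u.1 u.2 \in CC & #|u.1 :&: sdiff u.1 u.2| == a]].

Definition local_constant := 16 * 2 ^ k * K.

(** For each [C], a fixed [a]-subset of [C] joined to an arbitrary [z]-set outside [C] already gives
    enough edges. *)
Lemma card_local_edges a b CC : (forall C, C \in CC -> #|C| = a + b) ->
  #|CC| * 'C(#|V| - (a + b), z) <= #|local_edges a CC|.
Proof.
move=> CCc.
have cardE : #|local_edges a CC| = \sum_(C in CC)
    #|[set S : {set V} | (#|S| == z + a) && (#|S :&: C| == a)]|.
  rewrite -sum1_card (partition_big (fun u => sdiff u.1 u.2) (mem CC)) /=; last first.
    by move=> u; rewrite inE => /and3P[].
  apply: eq_bigr => C CCC.
  rewrite -(card_imset _ (f := fun S => (S, sdiff S C))); last by move=> S S' [].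
  rewrite -sum1_card; apply: eq_bigl => -[S T]; rewrite inE /=.
  apply/andP/imsetP => [[/and3P[cS SC cSC] /eqP eC]|[S' + [-> ->]]].
    by exists S; [rewrite inE cS -eC cSC | rewrite -eC sdiffKl].
  by rewrite inE sdiffKl => /andP[-> ->]; rewrite CCC.
rewrite cardE -sum_nat_const; apply: leq_sum => C /CCc cC.
have [A AC cA] : exists2 A : {set V}, A \subset C & #|A| = a.
  by apply: exists_subset_card; rewrite cC leq_addr.
have <- : #|~: C| = #|V| - (a + b) by have := cardsC C; lia.
rewrite -cards_draws -(@card_in_imset _ _ (fun S => S :|: A)) => [|S S'].
  apply: subset_leq_card; apply/subsetP=> x0 /imsetP[S]; rewrite inE => /andP[SC /eqP cS] ->.
  have dSC : S :&: C = set0.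
    by apply/eqP; rewrite setI_eq0 disjoints_subset.
  have dSA : S :&: A = set0 by apply/eqP; rewrite -subset0 -dSC setIS.
  by rewrite inE cardsU dSA cards0 subn0 cS cA eqxx /= setIUl dSC set0U (setIidPl AC) cA.
rewrite !inE => /andP[SC _] /andP[SC' _] /setP eS; apply/setP=> x; have := eS x; rewrite !inE.
have [xA|_] := boolP (x \in A); last by rewrite !orbF.
have xC := subsetP AC x xA.
have -> : x \in S = false by apply: contraTF xC => /(subsetP SC); rewrite inE.
by have -> : x \in S' = false by apply: contraTF xC => /(subsetP SC'); rewrite inE.
Qed.

(** Two edges with a common end point give a triple counted by [second_moment], with [a] and [b]
    exchanged on the second side, so [exists_matching] applies. Relative to the level of
    [(z + a)]-sets, the matching has density at least of order [#|CC| (l/n)^a]. *)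
Lemma local_matching a b CC :
  a + b <= k -> (forall C, C \in CC -> #|C| = a + b) ->
  codegree_bounded a CC -> codegree_bounded b CC ->
  exists M : {set {set V} * {set V}}, [/\ is_matching M,
    forall u, u \in M -> [/\ #|u.1| = z + a, #|u.2| = z + b & sdiff u.1 u.2 \in CC] &
    #|CC| * l ^ a * 'C(#|V|, z + a) <= local_constant * #|V| ^ a * #|M|].
Proof.
move=> abk CCc cda cdb.
have eE := card_local_edges CCc.
have snd_side u : u \in local_edges a CC ->
    #|u.2| = z + b /\ #|u.2 :&: sdiff u.1 u.2| = b.
  rewrite inE => /and3P[/eqP c1 /CCc]; set C := sdiff _ _ => cC /eqP cI.
  have -> : u.2 = sdiff u.1 C by rewrite sdiffKl.
  have := card_sdiff u.1 C; rewrite sdiffIl (setIidPl (subxx C)).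
  have := card_sdiff (u.1 :&: C) C; rewrite -setIA setIid cI cC c1; lia.
have [||M [ME Mm Mc]] := @exists_matching _ _ (local_edges a CC) K.
- apply: leq_trans (leq_mul (leqnn K) eE); apply: leq_trans (second_moment abk CCc cda).
  rewrite -(@card_in_imset _ _ (fun y : ({set V} * {set V}) * ({set V} * {set V}) =>
     (sdiff y.1.1 y.1.2, (sdiff y.2.1 y.2.2, y.1.1)))).
    apply: subset_leq_card; apply/subsetP=> _ /imsetP[y + ->]; rewrite !inE /=.
    move=> /and3P[/and3P[-> -> ->] /and3P[_ -> h] /eqP e] /=.
    by rewrite e h.
  move=> [[y1 y2] [y3 y4]] [[w1 w2] [w3 w4]]; rewrite !inE /=.
  move=> /and3P[_ _ /eqP <-] /and3P[_ _ /eqP <-] [e1 e2 e3].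
  by rewrite e3 in e1 e2 *; rewrite -[y2](sdiffKl w1) e1 -[y4](sdiffKl w1) e2 !sdiffKl.
- apply: leq_trans (leq_mul (leqnn K) eE).
  have CCc' C : C \in CC -> #|C| = b + a by rewrite addnC; apply: CCc.
  rewrite [a + b]addnC; rewrite [a + b]addnC in abk.
  apply: leq_trans (second_moment abk CCc' cdb).
  rewrite -(@card_in_imset _ _ (fun y : ({set V} * {set V}) * ({set V} * {set V}) =>
     (sdiff y.1.1 y.1.2, (sdiff y.2.1 y.2.2, y.1.2)))).
    apply: subset_leq_card; apply/subsetP=> _ /imsetP[y + ->]; rewrite inE.
    move=> /and3P[y1 y2 /eqP e].
    have [a1 a2] := snd_side _ y1; have [b1 b2] := snd_side _ y2.
    move: y1 y2; rewrite !inE /= a1 a2.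
    move=> /and3P[_ -> _] /and3P[_ -> _] /=.
    by rewrite !eqxx e b2 /=.
  move=> [[y1 y2] [y3 y4]] [[w1 w2] [w3 w4]]; rewrite !inE /=.
  move=> /and3P[_ _ /eqP <-] /and3P[_ _ /eqP <-] [e1 e2 e3].
  by rewrite e3 in e1 e2 *; rewrite -[y1](sdiffK _ w2) e1 -[y3](sdiffK _ w2) e2 !sdiffK.
exists M; split=> // [u uM|].
  have uE := subsetP ME u uM; have [c2 _] := snd_side u uE.
  by move: uE; rewrite inE => /and3P[/eqP ? ? _]; split.
have kl : k <= k * l by rewrite -[X in X <= _]muln1 leq_mul2l l_gt0 orbT.
have zV : z + a <= #|V| by lia.
have h1 := bin_lift zV.
have h2 : 'C(#|V| - a, z) <= 2 ^ k * 'C(#|V| - (a + b), z).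
  apply: (@leq_trans (2 ^ b * 'C(#|V| - a - b, z))).
    by apply: bin_drop; lia.
  by rewrite subnDA leq_mul2r leq_exp2l //; apply/orP; right; lia.
have lz : l ^ a <= z ^ a.
  have [->//|a0] := posnP a; rewrite leq_exp2r // z_def; nia.
rewrite /local_constant.
apply: (@leq_trans (#|CC| * (#|V| ^ a * (2 ^ k * 'C(#|V| - (a + b), z))))).
  rewrite -mulnA leq_mul2l; apply/orP; right; rewrite mulnC.
  apply: leq_trans (leq_mul (leqnn _) lz) _; apply: leq_trans h1 _.
  by rewrite leq_mul2l h2 orbT.
have -> : 16 * 2 ^ k * K * #|V| ^ a * #|M| = #|V| ^ a * (2 ^ k * (16 * K * #|M|)).
  by generalize K #|M| (2 ^ k) (#|V| ^ a); clear => *; lia.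
rewrite mulnCA [#|CC| * _]mulnCA; do 2![apply: leq_mul => //].
exact: leq_trans eE Mc.
Qed.

End LocalMatching.

(** * Product Kikuchi graphs *)

Lemma card_family_prod (I T : finType) (F : I -> {set T}) :
  #|[set f : {ffun I -> T} | [forall i, f i \in F i]]| = \prod_i #|F i|.
Proof.
rewrite (eq_card (B := family F)); last by move=> f; rewrite inE.
by rewrite card_family foldrE big_image.
Qed.

Section Product.
Variables (V I : finType) (H H0 : {set {set V}}).
Variables (D : {set V} -> I -> {set V}) (CC : {set V} -> I -> {set {set V}}).
Variables (a b : I -> nat) (k l z G t : nat).
Hypotheses (k_gt0 : 0 < k) (l_gt0 : 0 < l) (G_gt0 : 0 < G) (t_gt0 : 0 < t).
Hypotheses (z_def : z = k * l) (V_large : 4 * k * l <= #|V|).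
Hypothesis H0H : H0 \subset H.
Hypothesis abk : forall i, a i + b i <= k.
Hypothesis D_split : forall E, E \in H0 -> \big[@sdiff V/set0]_i D E i = E.
Hypothesis CC_card : forall E i C, E \in H0 -> C \in CC E i -> #|C| = a i + b i.
Hypothesis CC_leaf : forall E i C, E \in H0 -> C \in CC E i ->
  exists X : {set {set V}},
    [/\ X \subset H :\: H0, #|X| <= 1 & boundary X = sdiff (D E i) C].
Hypothesis CC_codega : forall E i, E \in H0 -> codegree_bounded l G (a i) (CC E i).
Hypothesis CC_codegb : forall E i, E \in H0 -> codegree_bounded l G (b i) (CC E i).
Hypothesis levels : \prod_i 'C(#|V|, z + b i) = \prod_i 'C(#|V|, z + a i).
Hypothesis t_large : 2 * \prod_i 'C(#|V|, z + a i) < 2 ^ t.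

Let kappa := local_constant k G.

(* The vertices of the Kikuchi graph are [I]-indexed families of vertex sets, so
   that the partial matching attached to a center is a product of matchings and
   the leaves chosen in different coordinates do not interact. *)
Theorem product_even_cover :
  4 * t * (kappa ^ #|I| * #|V| ^ (\sum_i a i)) <=
    \sum_(E in H0) (\prod_i #|CC E i|) * l ^ (\sum_i a i) ->
  exists2 S : {set {set V}}, even_cover H S & #|S| <= 2 * #|I|.+1 * t.
Proof.
move=> count.
pose n := #|V|; pose N := \prod_i 'C(n, z + a i).
have exM (q : {set V} * I) : exists M : {set {set V} * {set V}}, q.1 \in H0 ->
  [/\ is_matching M, forall u, u \in M ->
     [/\ #|u.1| = z + a q.2, #|u.2| = z + b q.2 & sdiff u.1 u.2 \in CC q.1 q.2] &
    #|CC q.1 q.2| * l ^ a q.2 * 'C(n, z + a q.2) <= kappa * n ^ a q.2 * #|M|].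
  have [qH|qH] := boolP (q.1 \in H0); last by exists set0.
  have [M MP] := local_matching k_gt0 l_gt0 z_def V_large (abk q.2)
     (fun C => CC_card qH) (CC_codega q.2 qH) (CC_codegb q.2 qH).
  by exists M.
have [M0 M0P] := fin_all_exists exM.
pose M E i := M0 (E, i).
have MP E i : E \in H0 -> [/\ is_matching (M E i), forall u, u \in M E i ->
     [/\ #|u.1| = z + a i, #|u.2| = z + b i & sdiff u.1 u.2 \in CC E i] &
    #|CC E i| * l ^ a i * 'C(n, z + a i) <= kappa * n ^ a i * #|M E i|].
  exact: M0P (E, i).
pose W := (bool * {ffun I -> {set V}})%type.
pose phi (w : W) : {set V} := \big[@sdiff V/set0]_i w.2 i.
pose lev (c : bool) i := if c then b i else a i.
pose Dom := [set w : W | [forall i, #|w.2 i| == z + lev w.1 i]].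
(* The boolean tells the two sides apart; [pr] puts the side of level [z + a] first, as the
   matchings do. *)
pose pr (w x : W) i := if w.1 then (x.2 i, w.2 i) else (w.2 i, x.2 i).
pose R E (w x : W) := [&& E \in H0, w.1 != x.1 & [forall i, pr w x i \in M E i]].
have R_sym E : symmetric (R E).
  move=> [c w] [d x]; rewrite /R /pr /= eq_sym; congr (_ && _).
  by case: c d => -[].
have R_fun E w x y : R E w x -> R E w y -> x = y.
  case: w x y => [c w] [d x] [e y] /and3P[EH /= cd /forallP wx] /and3P[_ /= ce /forallP wy].
  have -> : d = e by case: (c) (d) (e) cd ce => -[] [].
  congr pair; apply/ffunP => i; have [Mm _ _] := MP E i EH.
  have := Mm _ _ (wx i) (wy i); rewrite /pr /=; case: (c) => /=.
    by rewrite eqxx orbT => /(_ isT) [].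
  by rewrite eqxx => /(_ isT) [].
have R_dom E w x : R E w x -> w \in Dom.
  case: w x => [c w] [d x] /and3P[EH /= cd /forallP wx]; rewrite inE; apply/forallP => i /=.
  have [_ Mm _] := MP E i EH; have [h1 h2 _] := Mm _ (wx i).
  by apply/eqP; move: h1 h2; rewrite /pr /lev /=; case: (c).
have R_label E w x : E \in H0 -> R E w x ->
  exists L : {set {set V}}, [/\ L \subset H, #|L| <= #|I|.+1, L :&: H0 = [set E]
    & boundary L = sdiff (phi w) (phi x)].
  move=> EH /and3P[_ _ /forallP wx].
  have exX i : exists X : {set {set V}}, [/\ X \subset H :\: H0, #|X| <= 1
      & boundary X = sdiff (D E i) (sdiff (w.2 i) (x.2 i))].
    have [_ Mm _] := MP E i EH; have [_ _ h] := Mm _ (wx i).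
    have [X [X1 X2 X3]] := CC_leaf EH h; exists X; split=> //.
    by rewrite X3 /pr; case: (w.1) => //=; rewrite [sdiff (w.2 i) _]sdiffC.
  have [X XP] := fin_all_exists exX.
  pose Y := \big[@sdiff _/set0]_i X i.
  have YH : Y \subset H :\: H0.
    rewrite /Y; elim/big_ind: _ => [|A B|i _]; [exact: sub0set|exact: sdiff_subset|].
    by have [] := XP i.
  have cY : #|Y| <= #|I|.
    rewrite /Y -[#|I|]sum1_card; elim/big_ind2: _ => [|A m B m' hA hB|i _].
    - by rewrite cards0.
    - by apply: leq_trans (card_sdiff_le _ _) _; apply: leq_add.
    - by have [] := XP i.
  exists (sdiff [set E] Y); split.
  - apply: sdiff_subset; first by rewrite sub1set (subsetP H0H).
    by apply: subset_trans YH (subsetDl _ _).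
  - by apply: leq_trans (card_sdiff_le _ _) _; rewrite cards1.
  - rewrite sdiffIl (_ : Y :&: H0 = set0) ?sdiffs0.
      by apply/setIidPl; rewrite sub1set.
    apply/eqP; rewrite -subset0; apply/subsetP => F; rewrite inE => /andP[/(subsetP YH)].
    by rewrite inE => /andP[/negP].
  (* The parts [D E i] add up to [E] and cancel the center, which leaves the difference of the
     labels. *)
  - rewrite boundary_sdiff boundary1 /Y (big_morph _ (@boundary_sdiff V) (@boundary0 V)).
    rewrite (eq_bigr (fun i => sdiff (D E i) (sdiff (w.2 i) (x.2 i)))); last first.
      by move=> i _; have [] := XP i.
    by rewrite !big_split /= D_split // sdiffKl.
have kl : k <= k * l by rewrite -[X in X <= _]muln1 leq_mul2l l_gt0 orbT.
have N_gt0 : 0 < N.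
  by rewrite prodn_gt0 // => i; rewrite bin_gt0 /n; have := abk i; lia.
have card_lev c : #|[set w : W | (w.1 == c) && [forall i, #|w.2 i| == z + lev c i]]| = N.
  have <- : \prod_i 'C(n, z + lev c i) = N by case: c.
  rewrite -(eq_bigr _ (fun i _ => card_draws V (z + lev c i))) -card_family_prod.
  rewrite -(card_imset _ (f := fun f : {ffun I -> {set V}} => (c, f))); last by move=> f g [].
  apply: eq_card => -[d f]; rewrite inE /=; apply/andP/imsetP => [[/eqP -> h]|[g + [-> ->]]].
    by exists f => //; rewrite inE; apply/forallP=> i; rewrite inE (forallP h).
  by rewrite inE eqxx => /forallP h; split=> //; apply/forallP=> i; have := h i; rewrite inE.
have cDom : #|Dom| = 2 * N.
  rewrite mul2n -addnn -{1}(card_lev true) -(card_lev false).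
  rewrite -[X in _ = X]cardsUI [X in _ = _ + X]eq_card0 ?addn0.
    apply: eq_card => -[c f]; rewrite !inE /=.
    by case: c => /=; rewrite ?orbF.
  by move=> -[c f]; rewrite !inE /=; case: c; rewrite ?andbF.
(* One matching edge per coordinate gives an edge in both orientations; this factor 2 offsets the
   two sides of the vertex set. *)
have cR E : E \in H0 -> 2 * \prod_i #|M E i| <= #|[set u : W * W | R E u.1 u.2]|.
  move=> EH; rewrite -card_family_prod.
  pose F (c : bool) (f : {ffun I -> {set V} * {set V}}) : W * W :=
    if c then ((true, [ffun i => (f i).2]), (false, [ffun i => (f i).1]))
    else ((false, [ffun i => (f i).1]), (true, [ffun i => (f i).2])).
  set A := [set f | _]; have F_inj c : injective (F c).
    move=> f g; rewrite /F; case: c => -[/ffunP e1 /ffunP e2]; apply/ffunP => i;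
      have := e1 i; have := e2 i; rewrite !ffunE; case: (f i) (g i) => [? ?] [? ?] /= -> ->; done.
  rewrite mul2n -addnn -{1}(card_imset _ (F_inj true)) -(card_imset _ (F_inj false)).
  rewrite -cardsUI [X in _ + X <= _]eq_card0 ?addn0.
    apply: subset_leq_card; apply/subsetP=> u; rewrite in_setU.
    case/orP=> /imsetP[f]; rewrite [f \in _]inE => /forallP fM ->; rewrite inE /R EH /=;
      by apply/forallP => i; rewrite /pr /= !ffunE; case: (f i) (fM i).
  move=> u; rewrite !inE; apply/negbTE/negP => /andP[/imsetP[f _ ->] /imsetP[g _]].
  by rewrite /F => -[].
have D0 : Dom != set0 by rewrite -card_gt0 cDom muln_gt0.
apply: (walk_even_cover R_sym R_fun R_dom R_label t_gt0 D0); first by rewrite cDom.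
rewrite cDom; apply: (@leq_trans (\sum_(E in H0) 2 * \prod_i #|M E i|)); last first.
  exact: leq_sum.
rewrite -big_distrr /= mulnCA leq_mul2l /=.
pose s := \sum_i a i.
have kn_gt0 : 0 < kappa ^ #|I| * n ^ s.
  rewrite muln_gt0 !expn_gt0 /kappa /local_constant.
  have -> : 0 < n by rewrite /n; lia.
  by rewrite !muln_gt0 !expn_gt0 G_gt0 muln_gt0 k_gt0.
rewrite -(leq_pmul2r kn_gt0) mulnAC.
apply: leq_trans (leq_mul count (leqnn N)) _.
rewrite !big_distrl /=; apply: leq_sum => E EH.
rewrite -[kappa ^ _](prod_nat_const I kappa) /s !expn_sum /N.
rewrite -!big_split /=; apply: leq_prod => i _.
by have [_ _ h] := MP E i EH; rewrite [X in _ <= X]mulnC.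
Qed.

End Product.

(** * The even case and heavy links *)

Lemma bin_le_expn n m : 'C(n, m) <= n ^ m.
Proof.
have [mn|nm] := leqP m n; last by rewrite bin_small.
elim: m n mn => [|m IH] n mn; first by rewrite bin0.
case: n mn => // n mn; have e := mul_bin_diag n.+1 m; rewrite /= in e.
have h := IH n mn.
have le_exp : n ^ m <= n.+1 ^ m by case: (m) => // m'; rewrite leq_exp2r.
apply: (@leq_trans (m.+1 * 'C(n.+1, m.+1))); first by rewrite leq_pmull.
by rewrite -e expnS leq_mul2l (leq_trans h le_exp) orbT.
Qed.

(** The number of vertices is [n] to a power of order [l], which is why walks of length of order
    [l log n] suffice. *)
Lemma prod_bin_le (I : finType) n k l (a : I -> nat) :
  0 < n -> 0 < l -> #|I| <= k -> (forall i, a i <= k) ->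
  \prod_i 'C(n, k * l + a i) <= n ^ (2 * k * k * l).
Proof.
move=> n_gt0 l_gt0 Ik ak.
apply: (@leq_trans (\prod_(i : I) n ^ (2 * k * l))).
  apply: leq_prod => i _; apply: leq_trans (bin_le_expn _ _) _.
  by rewrite leq_pexp2l //; have := ak i; nia.
rewrite prod_nat_const -expnM leq_pexp2l // (_ : 2 * k * k * l = 2 * k * l * k); last by lia.
by rewrite leq_mul2l Ik orbT.
Qed.

Lemma codegree_mono (d G l n e e' : nat) : l <= n -> e <= e' ->
  d * l ^ e <= G * n ^ e -> d * l ^ e' <= G * n ^ e'.
Proof.
move=> ln ee h; rewrite -(subnKC ee) !expnD !mulnA leq_mul //.
by case: (e' - e) => // x; rewrite leq_exp2r.
Qed.

Lemma codegree_bounded1 (V : finType) (C : {set V}) l G a :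
  0 < G -> l <= #|V| -> codegree_bounded l G a [set C].
Proof.
move=> G_gt0 lV Y; apply: (@codegree_mono _ _ _ _ 0) => //.
rewrite !expn0 !muln1; apply: leq_trans G_gt0; rewrite -(cards1 C).
by apply: subset_leq_card; apply/subsetP => x; rewrite !inE => /andP[].
Qed.

(** One coordinate and no leaves: every hyperedge is a center and acts by itself, split evenly. *)
Theorem even_uniform_even_cover (V : finType) (H : {set {set V}}) (r l t : nat) :
  0 < r -> 0 < l -> 0 < t -> 4 * r.*2 * l <= #|V| -> uniform_hypergraph r.*2 H ->
  2 * #|V| ^ (2 * r.*2 * r.*2 * l) < 2 ^ t ->
  4 * t * (local_constant r.*2 1 * #|V| ^ r) <= #|H| * l ^ r ->
  exists2 S : {set {set V}}, even_cover H S & #|S| <= 4 * t.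
Proof.
move=> r_gt0 l_gt0 t_gt0 Vl Hk tl count.
have V_gt0 : 0 < #|V| by nia.
have lV : l <= #|V| by nia.
have k_gt0 : 0 < r.*2 by rewrite double_gt0.
have := @product_even_cover V 'I_1 H H (fun E _ => E) (fun E _ => [set E])
  (fun _ => r) (fun _ => r) r.*2 l (r.*2 * l) 1 t k_gt0 l_gt0 isT t_gt0 erefl Vl (subxx H).
rewrite card_ord expn1; apply.
- by move=> _; rewrite addnn.
- by move=> E _; rewrite big_ord1.
- by move=> E _ C EH; rewrite inE => /eqP ->; rewrite Hk // addnn.
- move=> E _ C EH; rewrite inE => /eqP ->; exists set0; split.
  + exact: sub0set.
  + by rewrite cards0.
  + by rewrite boundary0 sdiffss.
- by move=> E _ _; apply: codegree_bounded1.
- by move=> E _ _; apply: codegree_bounded1.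
- by [].
- apply: leq_ltn_trans tl; rewrite leq_mul2l /=.
  apply: (@prod_bin_le _ _ _ _ (fun=> r)) => // [|_]; first by rewrite card_ord.
  by rewrite -addnn leq_addr.
- rewrite big_ord1; apply: leq_trans count _; rewrite -sum_nat_const.
  by apply: leq_sum => E _; rewrite big_ord1 cards1 mul1n.
Qed.

(** * Light sets, links and buckets *)

Section OddLinks.
Variable V : finType.
Implicit Types (H L : {set {set V}}) (U E Y : {set V}).

Definition degree H U := #|[set E in H | U \subset E]|.

(* The exponent is a truncated subtraction: for [#|U| > r] the condition
   reads [degree H U <= 2]. *)
Definition light (l r : nat) H U :=
  degree H U * l ^ (r.+1 - #|U|) <= 2 * #|V| ^ (r.+1 - #|U|).

Definition link U H := [set E :\: U | E in H].

Lemma card_link U H : (forall E, E \in H -> U \subset E) -> #|link U H| = #|H|.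
Proof.
move=> UH; apply: card_in_imset => E F /UH UE /UH UF e.
by rewrite -(setID E U) -(setID F U) e (setIidPr UE) (setIidPr UF).
Qed.

Lemma link_codegree U H L Y : (forall E, E \in L -> U \subset E) -> L \subset H ->
  #|[set C in link U L | Y \subset C]| <=
    if [disjoint U & Y] then degree H (U :|: Y) else 0.
Proof.
move=> UL LH; case: ifPn => [_|dUY].
  apply: (@leq_trans #|link U [set E in H | U :|: Y \subset E]|); last exact: leq_imset_card.
  apply: subset_leq_card; apply/subsetP => C; rewrite inE => /andP[/imsetP[E EL ->] YE].
  apply/imsetP; exists E => //; rewrite inE (subsetP LH) //= subUset UL //=.
  by apply: subset_trans YE (subsetDl _ _).
rewrite leqn0 cards_eq0; apply/eqP/setP => C; rewrite !inE.
apply: contraNF dUY => /andP[/imsetP[E _ ->] /subsetDP[_]].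
by rewrite disjoint_sym.
Qed.

Lemma link_leaf U E : U \subset E -> boundary [set E] = sdiff U (E :\: U).
Proof.
move=> /subsetP UE; rewrite boundary1; apply/setP => x; rewrite in_sdiff inE.
by case: (boolP (x \in U)) => // /UE ->.
Qed.

(* A center [E] in a bucket of edges through a common [j]-set [U] is combined with
   a leaf of the same bucket, the two remainders acting on two separate coordinates. *)
Theorem bucket_even_cover H (P : {set {set {set V}}}) (r j l s t : nat) :
  let k := r.*2.+1 in let e := r.+1 - j in let K := local_constant k 4 in
  0 < r -> 0 < j < k -> 0 < l -> 0 < t -> 4 * k * l <= #|V| -> uniform_hypergraph k H ->
  (forall U, j < #|U| -> light l r H U) ->
  1 < s -> 2 * #|V| ^ e <= s * l ^ e <= 4 * #|V| ^ e ->
  trivIset P -> (forall B, B \in P -> B \subset H /\ #|B| = s) ->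
  (forall B, B \in P -> exists2 U : {set V}, #|U| = j & forall E, E \in B -> U \subset E) ->
  2 * #|V| ^ (2 * k * k * l) < 2 ^ t ->
  12 * t * (K ^ 2 * #|V| ^ r) <= #|cover P| * l ^ r ->
  exists2 S : {set {set V}}, even_cover H S & #|S| <= 6 * t.
Proof.
move=> k e K r_gt0 /andP[j_gt0 jk] l_gt0 t_gt0 Vl Hk lightH s_gt1 /andP[s_lo s_hi] tP PH PU tl count.
set n := #|V| in Vl s_lo s_hi tl count *.
have n_gt0 : 0 < n by apply: leq_trans Vl; rewrite !muln_gt0 l_gt0.
have ln : l <= n by apply: leq_trans Vl; rewrite leq_pmull.
have [Uf UfP] : exists Uf : {set {set V}} -> {set V}, forall B, B \in P ->
    #|Uf B| = j /\ forall E, E \in B -> Uf B \subset E.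
  have exU B : exists U : {set V}, B \in P -> #|U| = j /\ forall E, E \in B -> U \subset E.
    have [BP|] := boolP (B \in P); last by exists set0.
    by have [U ? ?] := PU B BP; exists U.
  by have [Uf ?] := fin_all_exists exU; exists Uf.
(* Half of each bucket, rounded down, serves as centers and the rest as leaves; [1 < s] ensures
   [s <= 3 * s./2]. *)
have [Bf BfP] : exists Bf : {set {set V}} -> {set {set V}}, forall B, B \in P ->
    Bf B \subset B /\ #|Bf B| = s./2.
  have exB B : exists B0 : {set {set V}}, B \in P -> B0 \subset B /\ #|B0| = s./2.
    have [BP|] := boolP (B \in P); last by exists set0.
    have [_ cB] := PH B BP.
    have [|B0 ? ?] := @exists_subset_card _ B s./2; last by exists B0.
    by rewrite cB; lia.
  by have [Bf ?] := fin_all_exists exB; exists Bf.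
pose H0 := \bigcup_(B in P) Bf B.
have H0cover : H0 \subset cover P.
  by apply/bigcupsP => B BP; apply: subset_trans (bigcup_sup _ BP); case: (BfP B BP).
have H0H : H0 \subset H.
  apply: subset_trans H0cover _; apply/bigcupsP => B BP; by case: (PH B BP).
pose blk E := pblock P E.
have blkP E : E \in H0 -> blk E \in P by move=> EH; rewrite pblock_mem ?(subsetP H0cover).
have blkE E : E \in H0 -> E \in blk E by move=> EH; rewrite mem_pblock (subsetP H0cover).
pose leaves E := blk E :\: Bf (blk E).
have leaves_sub E : E \in H0 -> leaves E \subset H :\: H0.
  move=> EH; apply/subsetP => F; rewrite !inE => /andP[FB FE].
  have [BH _] := PH _ (blkP E EH); rewrite (subsetP BH) // andbT.
  apply: contra FB => /bigcupP[B BP FBB].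
  have [BB _] := BfP B BP.
  suff -> : blk E = B by [].
  by rewrite -(def_pblock tP (blkP E EH) FE) (def_pblock tP BP (subsetP BB _ FBB)).
have leavesU E : E \in H0 -> forall F, F \in leaves E -> Uf (blk E) \subset F.
  by move=> EH F; rewrite inE => /andP[_ FE]; have [_] := UfP _ (blkP E EH); apply.
have leaves_card E : E \in H0 -> #|leaves E| = s - s./2.
  move=> EH; have [BB cB] := BfP _ (blkP E EH).
  by rewrite cardsD (setIidPr BB) cB; have [_ ->] := PH _ (blkP E EH).
have H0card : #|cover P| <= 3 * #|H0|.
  rewrite -(eqP tP) -[X in _ <= _ * X]sum1_card (partition_big blk (mem P)) //= big_distrr /=.
  apply: leq_sum => B BP; have [_ ->] := PH B BP; have [BB cB] := BfP B BP.
  apply: (@leq_trans (3 * s./2)); first by lia.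
  rewrite leq_mul2l /= -cB -sum1_card; rewrite [X in _ <= X](bigID (fun E => E \in Bf B)) /=.
  apply: leq_trans (leq_addr _ _); apply/eq_leq/eq_bigl => E.
  apply/idP/andP => [EB|[]//]; split=> //; apply/andP; split; first by apply/bigcupP; exists B.
  by rewrite /blk (def_pblock tP BP (subsetP BB E EB)).
(* Remainders have [c] points. Exchanging the halves [x] and [y] between the coordinates keeps the
   two levels equal in size when [c] is odd, and [e <= x], [e <= y] make the codegree bounds
   available. *)
pose c := k - j; pose x := c./2; pose y := c - x.
have xe : e <= x by rewrite /x /c /e /k; lia.
have ye : e <= y by rewrite /y /x /c /e /k; lia.
pose a (i : bool) := if i then x else y; pose b (i : bool) := if i then y else x.
(* Coordinate [true] moves by the remainder of the center itself; coordinate [false] stands for the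
   common set, which a leaf exchanges for its own remainder. *)
pose D E (i : bool) := if i then E :\: Uf (blk E) else Uf (blk E).
pose CC E (i : bool) := if i then [set E :\: Uf (blk E)] else link (Uf (blk E)) (leaves E).
have link_card E F : E \in H0 -> F \in H -> Uf (blk E) \subset F -> #|F :\: Uf (blk E)| = x + y.
  move=> EH FH UF; rewrite cardsD (setIidPr UF) Hk //.
  by have [-> _] := UfP _ (blkP E EH); rewrite /x /y /x /c; lia.
have UE E : E \in H0 -> Uf (blk E) \subset E.
  by move=> EH; have [_] := UfP _ (blkP E EH); apply; apply: blkE.
have codeg E w : E \in H0 -> e <= w -> codegree_bounded l 4 w (link (Uf (blk E)) (leaves E)).
  move=> EH ew Y; have [cU _] := UfP _ (blkP E EH).
  (* For empty [Y] the bucket size bounds the codegree; otherwise the common set enlarged by [Y] has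
     more than [j] points and is light. *)
  have [Y0|Y0] := eqVneq Y set0.
    rewrite Y0 cards0 subn0; apply: (codegree_mono ln ew); apply: leq_trans s_hi.
    rewrite leq_mul2r; apply/orP; right.
    apply: (@leq_trans #|link (Uf (blk E)) (leaves E)|).
      by apply: subset_leq_card; apply/subsetP=> C; rewrite inE => /andP[].
    by rewrite card_link ?leaves_card //; [lia|exact: leavesU].
  have := link_codegree Y (leavesU E EH) (subset_trans (leaves_sub E EH) (subsetDl _ _)).
  case: ifP => [dUY|_]; last by rewrite leqn0 => /eqP ->.
  move=> le_deg; have cUY : #|Uf (blk E) :|: Y| = j + #|Y|.
    by rewrite cardsU (disjoint_setI0 dUY) cards0 subn0 cU.
  have : light l r H (Uf (blk E) :|: Y).
    by apply: lightH; rewrite cUY -[X in X < _]addn0 ltn_add2l card_gt0.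
  rewrite /light cUY subnDA -/e -/n => lt.
  apply: (codegree_mono ln (leq_sub2r #|Y| ew)).
  apply: leq_trans (leq_mul le_deg (leqnn _)) _; apply: leq_trans lt _.
  by rewrite leq_mul2r orbT.
have := @product_even_cover V bool H H0 D CC a b k l (k * l) 4 t
  isT l_gt0 isT t_gt0 erefl Vl H0H.
rewrite card_bool; apply.
- by case; rewrite /a /b /x /y /x /c; lia.
- move=> E EH; rewrite big_bool /D /= sdiffC -link_leaf ?boundary1 //; exact: UE.
- move=> E [] C EH; rewrite /CC /a /b.
    by rewrite inE => /eqP ->; apply: link_card => //; [exact: (subsetP H0H)|exact: UE].
  move=> /imsetP[F FL ->]; rewrite addnC; apply: link_card => //; last exact: leavesU FL.
  by apply: (subsetP (subset_trans (leaves_sub E EH) (subsetDl _ _))).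
- move=> E [] C EH; rewrite /CC /D.
    rewrite inE => /eqP ->; exists set0; split; rewrite ?sub0set ?cards0 //.
    by rewrite boundary0 sdiffss.
  move=> /imsetP[F FL ->]; exists [set F]; split; rewrite ?cards1 //.
    by rewrite sub1set (subsetP (leaves_sub E EH)).
  by apply: link_leaf; apply: leavesU FL.
- move=> E [] EH; rewrite /CC /a; [exact: codegree_bounded1|exact: codeg].
- move=> E [] EH; rewrite /CC /b; [exact: codegree_bounded1|exact: codeg].
- by rewrite !big_bool /= mulnC.
- apply: leq_ltn_trans tl; rewrite leq_mul2l /=; apply: prod_bin_le => //.
    by rewrite card_bool /k; lia.
  by case; rewrite /a /y /x /c; lia.
- rewrite (_ : \sum_i a i = e + (c - e)); last first.
    by rewrite big_bool /= /a /y; move: (xe) (half_leq (leqnn c)); rewrite /x; lia.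
  apply: (@leq_trans (\sum_(E in H0) n ^ e * l ^ (c - e))); last first.
    apply: leq_sum => E EH; rewrite big_bool /CC /= cards1 mul1n card_link; last exact: leavesU.
    rewrite leaves_card // expnD mulnA leq_mul2r; apply/orP; right.
    rewrite -(leq_pmul2l (isT : 0 < 2)); apply: leq_trans s_lo _.
    by rewrite mulnA leq_mul2r; apply/orP; right; lia.
  set f := c - e; have fr : f <= r by rewrite /f /c /e /k; lia.
  (* The leaves, of order [(n/l)^e] in number, absorb [e] of the [c] factors [n/l]; the other
     [f <= r] are paid for by the number of centers. *)
  have core : 4 * t * K ^ 2 * n ^ f <= #|H0| * l ^ f.
    have nf_gt0 : 0 < n ^ (r - f) by rewrite expn_gt0 n_gt0.
    rewrite -(leq_pmul2r nf_gt0) -[X in X <= _]mulnA -expnD subnKC //.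
    apply: (@leq_trans (#|H0| * l ^ r)).
      rewrite -(leq_pmul2l (isT : 0 < 3)) [X in _ <= X]mulnA.
      apply: leq_trans (leq_mul H0card (leqnn _)); apply: leq_trans count.
      by rewrite !mulnA.
    rewrite -[in X in X <= _](subnKC fr) expnD mulnA leq_mul2l; apply/orP; right.
    by case: (r - f) => // w; rewrite leq_exp2r.
  rewrite sum_nat_const expnD.
  have -> : 4 * t * (K ^ 2 * (n ^ e * n ^ f)) = n ^ e * (4 * t * K ^ 2 * n ^ f).
    by generalize (K ^ 2) (n ^ e) (n ^ f); clear => *; lia.
  by rewrite [X in _ <= X]mulnCA leq_mul2l core orbT.
Qed.

End OddLinks.

(** * Stars and the odd case *)

Lemma leq_card_bigcup (I T : finType) (F : I -> {set T}) (m : nat) :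
  (forall i, #|F i| <= m) -> #|\bigcup_i F i| <= #|I| * m.
Proof.
move=> Fm; apply: (@leq_trans (\sum_i #|F i|)).
  elim/big_rec2: _ => [|i s A _ IH]; first by rewrite cards0.
  by rewrite (leq_trans (leq_card_setU _ _).1) ?leq_add2l.
by rewrite -sum_nat_const; apply: leq_sum.
Qed.

Lemma big_sdiff_enum (T : finType) (x0 : T) (A : {set T}) k : #|A| = k ->
  \big[@sdiff T/set0]_(i < k) [set nth x0 (enum A) i] = A.
Proof.
move=> <-; rewrite cardE.
rewrite -(big_mkord xpredT (fun i => [set nth x0 (enum A) i])).
rewrite -(big_nth x0 xpredT (fun x => [set x])).
rewrite -[RHS](set_enum A); move: (enum_uniq A); elim: (enum A) => [|x s IH] /=.
  by rewrite big_nil => _; apply/setP => y; rewrite !inE.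
case/andP => xs us; rewrite big_cons IH //; apply/setP => y; rewrite in_sdiff !inE.
by case: eqP => // ->; rewrite (negbTE xs).
Qed.

Section Odd.
Variable V : finType.
Implicit Types (H : {set {set V}}) (U E Y : {set V}).

(* A center [E] is combined with one leaf through each of its vertices. *)
Theorem star_even_cover H (r l d t : nat) :
  let k := r.*2.+1 in let K := local_constant k 4 in
  0 < r -> 0 < l -> 0 < t -> 4 * k * l <= #|V| -> uniform_hypergraph k H ->
  (forall U, 0 < #|U| -> light l r H U) ->
  4 * #|V| * d <= #|H| ->
  2 * #|V| ^ (2 * k * k * l) < 2 ^ t ->
  8 * t * (K ^ k * #|V| ^ (r * k)) <= #|H| * (d ^ k * l ^ (r * k)) ->
  exists2 S : {set {set V}}, even_cover H S & #|S| <= 2 * k.+1 * t.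
Proof.
move=> k K r_gt0 l_gt0 t_gt0 Vl Hk lightH d_small tl count.
set n := #|V| in Vl d_small tl count *.
have n_gt0 : 0 < n by apply: leq_trans Vl; rewrite !muln_gt0 l_gt0.
have ln : l <= n by apply: leq_trans Vl; rewrite leq_pmull.
have [x0 _] : exists x0, x0 \in V by apply/card_gt0P.
pose Hv v := [set E in H | v \in E].
(* [d] leaves are reserved at every vertex of degree at least [d]; hyperedges through a vertex of
   smaller degree are excluded as centers. *)
have [Rf RfP] : exists Rf : V -> {set {set V}}, forall v,
    [/\ Rf v \subset Hv v, #|Rf v| <= d & d <= #|Hv v| -> #|Rf v| = d].
  have exR v : exists L : {set {set V}},
      [/\ L \subset Hv v, #|L| <= d & d <= #|Hv v| -> #|L| = d].
    have [dv|dv] := leqP d #|Hv v|.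
      by have [L L1 L2] := exists_subset_card dv; exists L; rewrite L2.
    by exists set0; split; rewrite ?sub0set ?cards0 // leqNgt dv.
  by have [Rf ?] := fin_all_exists exR; exists Rf.
pose H1 := \bigcup_v Rf v.
pose low := \bigcup_v (if #|Hv v| < d then Hv v else set0).
pose H0 := H :\: (H1 :|: low).
have cH1 : #|H1| <= n * d by apply: leq_card_bigcup => v; case: (RfP v).
have clow : #|low| <= n * d.
  by apply: leq_card_bigcup => v; case: ifP => [/ltnW //|_]; rewrite cards0.
(* Reserved leaves and excluded hyperedges number at most [n * d] each, hence at most half of [H]
   together. *)
have cH0 : #|H| <= 2 * #|H0|.
  have h1 := cardsID (H1 :|: low) H; have h2 := (leq_card_setU H1 low).1.
  have h3 := subset_leq_card (subsetIr H (H1 :|: low)).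
  rewrite -/H0 in h1; move: d_small; rewrite -mulnA.
  by generalize (n * d) #|H0| h1 h2 h3 cH1 clow; clear => *; lia.
have H0H : H0 \subset H by apply: subsetDl.
have H0deg E v : E \in H0 -> v \in E -> #|Rf v| = d.
  move=> EH vE; have [_ _ ->//] := RfP v; rewrite leqNgt; apply/negP => dv.
  move: EH; rewrite !inE negb_or => /andP[/andP[_ /negP Elow] EH]; apply: Elow.
  by apply/bigcupP; exists v => //; rewrite dv inE EH.
have RfH v : Rf v \subset H.
  have [RH _ _] := RfP v; apply: subset_trans RH _.
  by apply/subsetP => E; rewrite inE => /andP[].
have RfH0 v : Rf v \subset H :\: H0.
  apply/subsetP => E ER; rewrite inE (subsetP (RfH v)) // andbT.
  apply/negP; rewrite !inE => /andP[/norP[/negP EH1 _] _]; apply: EH1.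
  by apply/bigcupP; exists v.
have RfU v E : E \in Rf v -> [set v] \subset E.
  by have [RH _ _] := RfP v; move=> /(subsetP RH); rewrite inE sub1set => /andP[].
pose vx E (i : 'I_k) := nth x0 (enum E) i.
have vxE E i : E \in H0 -> vx E i \in E.
  move=> EH; rewrite -mem_enum mem_nth // -cardE Hk //; exact: (subsetP H0H).
have codeg E (i : 'I_k) : E \in H0 ->
    codegree_bounded l 4 r (link [set vx E i] (Rf (vx E i))).
  move=> EH Y; have := link_codegree Y (RfU (vx E i)) (RfH _).
  case: ifP => [dUY|_]; last by rewrite leqn0 => /eqP ->.
  move=> le_deg; have cUY : #|[set vx E i] :|: Y| = #|Y|.+1.
    by rewrite cardsU (disjoint_setI0 dUY) cards0 subn0 cards1.
  have : light l r H ([set vx E i] :|: Y) by apply: lightH; rewrite cUY.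
  rewrite /light cUY subSS -/n => lt.
  apply: leq_trans (leq_mul le_deg (leqnn _)) _; apply: leq_trans lt _.
  by rewrite leq_mul2r orbT.
have := @product_even_cover V 'I_k H H0 (fun E i => [set vx E i])
  (fun E i => link [set vx E i] (Rf (vx E i))) (fun=> r) (fun=> r) k l (k * l) 4 t
  isT l_gt0 isT t_gt0 erefl Vl H0H.
rewrite card_ord; apply.
- by move=> _; rewrite addnn /k.
- by move=> E EH; apply: big_sdiff_enum; rewrite Hk // (subsetP H0H).
- move=> E i C EH /imsetP[F FR ->]; rewrite cardsD (setIidPr (RfU _ _ FR)) cards1.
  by rewrite Hk ?(subsetP (RfH _) _ FR) // /k subn1 addnn.
- move=> E i C EH /imsetP[F FR ->]; exists [set F]; split; rewrite ?cards1 //.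
    by rewrite sub1set (subsetP (RfH0 _) _ FR).
  by apply: link_leaf; apply: RfU FR.
- by move=> E i; apply: codeg.
- by move=> E i; apply: codeg.
- by [].
- apply: leq_ltn_trans tl; rewrite leq_mul2l /=.
  apply: (@prod_bin_le _ _ _ _ (fun=> r)) => // [|_]; first by rewrite card_ord.
  by rewrite /k; lia.
- rewrite sum_nat_const card_ord [k * r]mulnC.
  apply: (@leq_trans (\sum_(E in H0) d ^ k * l ^ (r * k))); last first.
    apply: leq_sum => E EH; rewrite leq_mul2r; apply/orP; right.
    rewrite (eq_bigr (fun=> d)); first by rewrite prod_nat_const card_ord.
    move=> i _; rewrite card_link; last exact: RfU.
    by apply: (H0deg E) => //; apply: vxE.
  rewrite sum_nat_const -(leq_pmul2l (isT : 0 < 2)) [X in _ <= X]mulnA.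
  apply: leq_trans (leq_mul cH0 (leqnn _)); apply: leq_trans count.
  by rewrite !mulnA.
Qed.

(** The sizes [j = k - 1, ..., 1] are treated in turn. A maximal family of disjoint buckets over
    heavy [j]-sets either covers a proportion [1/(2k)] of [H], and [bucket_even_cover] applies, or
    is deleted, after which no [j]-set is heavy. The [2r] deletions leave at least half of [H], with
    all nonempty sets light, for [star_even_cover]; hence the 8 in [d]. *)
Theorem odd_uniform_even_cover H (r l t : nat) :
  let k := r.*2.+1 in let K := local_constant k 4 in let d := #|H| %/ (8 * #|V|) in
  0 < r -> 0 < l -> 0 < t -> 4 * k * l <= #|V| -> uniform_hypergraph k H ->
  2 * #|V| ^ (2 * k * k * l) < 2 ^ t ->
  2 * k * (12 * t * (K ^ 2 * #|V| ^ r)) <= #|H| * l ^ r ->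
  16 * t * (K ^ k * #|V| ^ (r * k)) <= #|H| * (d ^ k * l ^ (r * k)) ->
  exists2 S : {set {set V}}, even_cover H S & #|S| <= 2 * k.+1 * t.
Proof.
move=> k K d r_gt0 l_gt0 t_gt0 Vl Hk tl count1 count2.
set n := #|V| in Vl tl count1 count2 *.
have n_gt0 : 0 < n by apply: leq_trans Vl; rewrite !muln_gt0 l_gt0.
have ln : l <= n by apply: leq_trans Vl; rewrite leq_pmull.
have lift_cover H' m : H' \subset H -> m <= 2 * k.+1 * t ->
    (exists2 S : {set {set V}}, even_cover H' S & #|S| <= m) ->
    exists2 S : {set {set V}}, even_cover H S & #|S| <= 2 * k.+1 * t.
  move=> H'H le_m [S [SH' S0 Sv] cS]; exists S; last exact: leq_trans cS le_m.
  by split=> //; apply: subset_trans SH' H'H.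
have sub_uniform H' : H' \subset H -> uniform_hypergraph k H'.
  by move=> H'H E EH; apply: Hk; apply: (subsetP H'H).
have step i : i < k ->
  (exists2 S : {set {set V}}, even_cover H S & #|S| <= 2 * k.+1 * t) \/
  exists H' : {set {set V}}, [/\ H' \subset H, 2 * k * #|H| <= 2 * k * #|H'| + i * #|H|
    & forall U, k - i <= #|U| -> light l r H' U].
  elim: i => [|i IH] ik.
    (* A set of at least [k] vertices lies in at most one hyperedge. *)
    right; exists H; split=> // [|U]; first by rewrite leq_addr.
    rewrite subn0 => kU; rewrite /light (_ : r.+1 - #|U| = 0); last first.
      by move: kU; rewrite /k; clear; lia.
    rewrite !expn0 !muln1; apply: (@leq_trans 1) => //.
    apply/card_le1_eqP => E F; rewrite !inE => /andP[EH UE] /andP[FH UF].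
    have eqU A : A \in H -> U \subset A -> U = A.
      by move=> AH UA; apply/eqP; rewrite eqEcard UA Hk.
    by rewrite -(eqU E) // -(eqU F).
  case: (IH (ltnW ik)) => [|[H' [H'H cH' lightH']]]; first by left.
  pose j := k - i.+1; pose e := r.+1 - j.
  have j_gt0 : 0 < j by rewrite subn_gt0.
  have jk : j < k by rewrite /j ltn_subrL.
  (* The least integer above [2 (n/l)^e], so that every heavy [j]-set has room for a bucket;
     [l <= n] keeps it below [4 (n/l)^e]. *)
  pose s := ((2 * n ^ e) %/ l ^ e).+1.
  have le_gt0 : 0 < l ^ e by rewrite expn_gt0 l_gt0.
  have lne : l ^ e <= n ^ e by case: (e) => // e'; rewrite leq_exp2r.
  have q1 := leq_trunc_div (2 * n ^ e) (l ^ e).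
  have q2 : 2 * n ^ e < s * l ^ e by rewrite /s -ltn_divLR.
  have s_gt1 : 1 < s by rewrite /s ltnS divn_gt0 // (leq_trans lne) // leq_pmull.
  pose ok (P : {set {set {set V}}}) := trivIset P &&
    [forall B in P, [&& B \subset H', #|B| == s &
       [exists U : {set V}, (#|U| == j) && [forall E in B, U \subset E]]]].
  have ok0 : ok set0.
    rewrite /ok; apply/andP; split; last by apply/forall_inP => B; rewrite inE.
    by rewrite /trivIset /cover !big_set0 cards0.
  case: (@arg_maxnP _ set0 ok (fun P => #|P|) ok0) => P /andP[tP /forall_inP PP] Pmax.
  have [big|small] := leqP #|H| (2 * k * #|cover P|).
    left; apply: (lift_cover H' (6 * t)) => //; first by rewrite leq_mul2r /k; move: r_gt0; clear; lia.
    apply: (@bucket_even_cover V H' P r j l s t) => //.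
    - by rewrite j_gt0 jk.
    - exact: sub_uniform.
    - by move=> U jU; apply: lightH'; move: jU ik; rewrite /j; clear; lia.
    - rewrite -/n -/e (ltnW q2) /=.
      by rewrite /s mulSn; generalize (l ^ e) (n ^ e) q1 lne; clear => *; lia.
    - by move=> B /PP/and3P[? /eqP].
    - move=> B /PP/and3P[_ _ /existsP[U /andP[/eqP cU /forall_inP UB]]].
      by exists U.
    - have k2 : 0 < 2 * k by [].
      rewrite -(leq_pmul2l k2); apply: leq_trans count1 _.
      by rewrite mulnA leq_mul2r big orbT.
  right; exists (H' :\: cover P); split.
  - exact: subset_trans (subsetDl _ _) H'H.
  - have h1 := cardsID (cover P) H'; have h2 := subset_leq_card (subsetIr H' (cover P)).
    have h3 : 2 * k * #|H'| <= 2 * k * #|cover P| + 2 * k * #|H' :\: cover P|.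
      by rewrite -mulnDr leq_mul2l -h1 leq_add2r h2 orbT.
    rewrite mulSn addnA; apply: leq_trans cH' _; rewrite leq_add2r.
    by apply: leq_trans h3 _; rewrite addnC leq_add2l ltnW.
  - move=> U jU; have sub : degree (H' :\: cover P) U <= degree H' U.
      apply: subset_leq_card; apply/subsetP => E; rewrite !inE.
      by move=> /andP[/andP[_ ->] ->].
    have [kiU|] := leqP (k - i) #|U|.
      by apply: leq_trans (lightH' U kiU); rewrite leq_mul2r sub orbT.
    move=> Uki; have cU : #|U| = j by move: Uki jU ik; rewrite /j; clear; lia.
    rewrite /light cU -/e -/n -leq_divRL //.
    (* A heavy [j]-set would provide one more bucket disjoint from the others, against
       maximality. *)
    rewrite leqNgt; apply/negP => heavy.
    have [B BU cB] := exists_subset_card heavy.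
    have BH : B \subset H' :\: cover P.
      by apply: subset_trans BU _; apply/subsetP => E; rewrite inE => /andP[].
    have B0 : B != set0 by rewrite -card_gt0 cB.
    have disj B' : B' \in P -> [disjoint B & B'].
      move=> BP; rewrite disjoints_subset; apply: subset_trans BH _.
      rewrite setDE; apply: subset_trans (subsetIr _ _) _; rewrite setCS.
      exact: bigcup_sup.
    have P0 : set0 \notin P.
      by apply/negP => /PP/and3P[_]; rewrite cards0.
    have [tBP BP] := trivIsetU1 disj tP P0.
    have /Pmax : ok (B |: P).
      rewrite /ok tBP; apply/forall_inP => B'; rewrite !inE => /predU1P[->|/PP //].
      rewrite (subset_trans BH (subsetDl _ _)) cB eqxx /=; apply/existsP; exists U.
      rewrite cU eqxx; apply/forall_inP => E /(subsetP BU).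
      by rewrite inE => /andP[].
    by rewrite cardsU1 BP /= add1n ltnn.
have [//|[H' [H'H cH' lightH']]] := step r.*2 (leqnn _).
have H'2 : #|H| <= 2 * #|H'|.
  have : (2 * k - r.*2) * #|H| <= 2 * k * #|H'|.
    by rewrite mulnBl leq_subLR addnC.
  have k2 : k <= 2 * k - r.*2 by rewrite /k; clear; lia.
  move=> h; have k_gt0 : 0 < k by [].
  rewrite -(leq_pmul2l k_gt0); apply: leq_trans (leq_mul k2 (leqnn _)) _.
  by apply: leq_trans h _; rewrite mulnA [k * 2]mulnC.
apply: (lift_cover H' (2 * k.+1 * t)) => //.
apply: (@star_even_cover H' r l d t) => //.
- exact: sub_uniform.
- by move=> U U0; apply: lightH'; rewrite /k subSnn.
- rewrite -(leq_pmul2l (isT : 0 < 2)); apply: leq_trans H'2.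
  apply: leq_trans (leq_trunc_div #|H| (8 * n)).
  by rewrite -/d [d * _]mulnC !mulnA.
- rewrite -(leq_pmul2l (isT : 0 < 2)) [X in _ <= X]mulnA.
  apply: leq_trans (leq_mul H'2 (leqnn _)); apply: leq_trans count2.
  by rewrite !mulnA.
Qed.

End Odd.

(** * Asymptotics *)

Import Order.TTheory GRing.Theory Num.Theory.
Local Open Scope ring_scope.

(** The walk length [t]; the final 2 pays for the two sides of the vertex set and for strictness in
    [#|D| < 2 ^ t]. *)
Definition steps (k n l : nat) : nat := (2 * k * k * l * (trunc_log 2 n).+1 + 2)%N.

Lemma steps_large k n l : (2 * n ^ (2 * k * k * l) < 2 ^ steps k n l)%N.
Proof.
have nlt : (n <= 2 ^ (trunc_log 2 n).+1)%N by apply/ltnW/trunc_log_ltn.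
rewrite /steps; set e := (2 * k * k * l)%N.
apply: (@leq_ltn_trans (2 * (2 ^ (trunc_log 2 n).+1) ^ e)%N).
  by rewrite leq_mul2l /=; case: (e) => // e'; rewrite leq_exp2r.
by rewrite -expnM -expnS ltn_exp2l // mulnC addn2.
Qed.

Lemma steps_gt0 k n l : (0 < steps k n l)%N.
Proof. by rewrite /steps addn2. Qed.

(** For [4kl > n] the even case is run with [l'] in place of [l]: covers only get smaller, and
    [n / l' <= 8k] costs a constant factor. *)
Lemma reduced_level k n l : (0 < k)%N -> (8 * k <= n)%N -> (n < 4 * k * l)%N ->
  let l' := (n %/ (4 * k))%N in
  [/\ (0 < l')%N, (4 * k * l' <= n)%N, (l' <= l)%N & (n <= 8 * k * l')%N].
Proof.
move=> k_gt0 kn nl l'; have k4 : (0 < 4 * k)%N by rewrite muln_gt0.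
have l'_gt0 : (0 < l')%N by rewrite divn_gt0 //; lia.
have := ltn_ceil n k4; rewrite -/l' => lt_n; split=> //.
- by rewrite mulnC leq_trunc_div.
- by rewrite ltnW // ltn_divLR // mulnC.
- by move: lt_n l'_gt0; clear; nia.
Qed.

Section Reals.
Variable R : realType.
Implicit Types (n k l r : nat).

Lemma ln2_gt0 : 0 < ln (2 : R).
Proof. by apply: ln_gt0; lra. Qed.

Lemma log2_ge n m : (2 ^ m <= n)%N -> m%:R <= log2 (n%:R : R).
Proof.
move=> mn; rewrite /log2 ler_pdivlMr ?ln2_gt0 // mulr_natl -lnXn ?ltr0n //.
have n_gt0 : (0 < n)%N by apply: leq_trans mn; rewrite expn_gt0.
by rewrite ler_ln ?posrE ?exprn_gt0 ?ltr0n // -natrX ler_nat.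
Qed.

Lemma steps_le k n l : (1 < n)%N -> (0 < l)%N ->
  (steps k n l)%:R <= (4 * k * k + 2)%:R * (l%:R * log2 (n%:R : R)).
Proof.
move=> n_gt1 l_gt0; set L := log2 _.
have L_ge1 : 1 <= L by apply: (@log2_ge n 1).
have tL : (trunc_log 2 n)%:R <= L by apply: log2_ge; apply: trunc_logP => //; apply: ltnW.
have l_ge1 : (1 : R) <= l%:R by rewrite ler1n.
have lL : 1 <= l%:R * L by nra.
rewrite /steps natrD [X in _ <= X * _]natrD mulrDl; apply: lerD; last by lra.
rewrite -[(trunc_log 2 n).+1]addn1 natrM [(_ + 1)%:R]natrD (_ : (4 * k * k)%:R = (2 * k * k)%:R * 2 :> R); last first.
  by rewrite -natrM; congr (_%:R); lia.
rewrite [(2 * k * k * l)%:R]natrM -!mulrA ler_wpM2l ?ler0n //.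
rewrite mulrCA ler_wpM2l ?ler0n //; lra.
Qed.

Definition even_constant k : nat := (4 * local_constant k 1 * (4 * k * k + 2))%N.

Lemma even_case k n l (V : finType) (H : {set {set V}}) :
  (0 < k)%N -> ~~ odd k -> (1 < n)%N -> (0 < l)%N -> (4 * k * l <= n)%N -> #|V| = n ->
  uniform_hypergraph k H ->
  (even_constant k)%:R * n%:R * (n%:R / l%:R) `^ (k%:R / 2 - 1) * log2 n%:R <= #|H|%:R :> R ->
  exists2 S : {set {set V}}, even_cover H S &
    #|S|%:R <= 4 * ((4 * k * k + 2)%:R * (l%:R * log2 (n%:R : R))).
Proof.
move=> k_gt0 ek n_gt1 l_gt0 kln Vn Hk Hbig.
pose r := k./2; have kE : k = r.*2 by rewrite /r even_halfK.
have r_gt0 : (0 < r)%N by move: k_gt0; rewrite kE double_gt0.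
have n0 : (0 : R) < n%:R by rewrite ltr0n; apply: ltnW.
have l0 : (0 : R) < l%:R by rewrite ltr0n.
set L := log2 (n%:R : R) in Hbig *.
have ts := steps_le k n_gt1 l_gt0; rewrite -/L in ts.
have [||||S SH cS] := @even_uniform_even_cover V H r l (steps k n l) r_gt0 l_gt0
  (steps_gt0 k n l).
- by rewrite Vn -kE.
- by rewrite -kE.
- by rewrite Vn -kE steps_large.
- rewrite -(ler_nat R) Vn -kE.
  have powE : (n%:R / l%:R : R) `^ (k%:R / 2 - 1) = (n%:R / l%:R) ^+ r.-1.
    rewrite -powR_mulrn ?divr_ge0 ?ler0n //; congr (_ `^ _).
    by rewrite kE -muln2 natrM -[in LHS](prednK r_gt0) -addn1 natrD; lra.
  rewrite powE in Hbig.
  rewrite [X in _ <= X]natrM.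
  apply: (@le_trans _ _ ((even_constant k)%:R * n%:R * (n%:R / l%:R) ^+ r.-1 * L * (l ^ r)%:R)); last first.
    by rewrite ler_wpM2r ?ler0n.
  have -> : (even_constant k)%:R * n%:R * (n%:R / l%:R) ^+ r.-1 * L * (l ^ r)%:R =
     (even_constant k)%:R * (l%:R * L) * n%:R ^+ r :> R.
    rewrite natrX -[in X in X = _](prednK r_gt0) -[in X in _ = X](prednK r_gt0) !exprS expr_div_n.
    have : (l%:R : R) ^+ r.-1 != 0 by rewrite expf_neq0 // gt_eqF.
    by move=> h; field.
  rewrite /even_constant; generalize (local_constant k 1) => K.
  rewrite !natrM natrX [X in _ <= X](_ : _ =
    4 * ((4 * k * k + 2)%:R * (l%:R * L)) * (K%:R * n%:R ^+ r)); last by ring.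
  by rewrite ler_wpM2r ?mulr_ge0 ?exprn_ge0 ?ler0n // ler_wpM2l.
exists S => //; apply: (@le_trans _ _ (4 * steps k n l)%:R); first by rewrite ler_nat.
by rewrite natrM ler_wpM2l.
Qed.

(** The summands serve the rounding in [#|H| %/ (8 * n)], the bucket count and the star count;
    [4 * k * k + 2] bounds [steps] relative to [l log n]. *)
Definition odd_constant k : nat :=
  (16 + 24 * k * local_constant k 4 ^ 2 * (4 * k * k + 2)
    + 16 * local_constant k 4 ^ k * (4 * k * k + 2))%N.

(** Put [X = n/l], [Y = X^(r - 1/2)] and [L1 = L^(1/(k+1))]. The bucket count needs
    [L <= sqrt X * L1], which holds because [l <= n / log^2 n] gives [L <= sqrt X]. The star count
    involves the power [k + 1] of [Y L1], and [X (Y L1)^(k+1) = X^(rk) L] explains the exponent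
    [1/(k+1)]. *)
Lemma odd_case k n l (V : finType) (H : {set {set V}}) :
  odd k -> (1 < k)%N -> (1 < n)%N -> (0 < l)%N -> (4 * k * l <= n)%N -> #|V| = n ->
  l%:R <= n%:R / log2 (n%:R : R) ^+ 2 -> uniform_hypergraph k H ->
  (odd_constant k)%:R * n%:R * (n%:R / l%:R) `^ (k%:R / 2 - 1)
    * log2 n%:R `^ (k.+1%:R^-1) <= #|H|%:R :> R ->
  exists2 S : {set {set V}}, even_cover H S &
    #|S|%:R <= (2 * k.+1)%:R * ((4 * k * k + 2)%:R * (l%:R * log2 (n%:R : R))).
Proof.
move=> ok k_gt1 n_gt1 l_gt0 kln Vn ln Hk Hbig.
pose r := k./2; have kE : k = r.*2.+1 by rewrite /r -[LHS]odd_double_half ok.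
have k1E : k.+1 = (2 * r.+1)%N by rewrite mul2n doubleS -kE.
have r_gt0 : (0 < r)%N by move: k_gt1; rewrite kE; case: (r).
have n0 : (0 : R) < n%:R by rewrite ltr0n; apply: ltnW.
have l0 : (0 : R) < l%:R by rewrite ltr0n.
have L_ge1 : 1 <= log2 (n%:R : R) by apply: (@log2_ge n 1).
set L := log2 (n%:R : R) in ln Hbig L_ge1 *.
have ts := steps_le k n_gt1 l_gt0; rewrite -/L in ts.
set t := steps k n l in ts; set T := (4 * k * k + 2)%:R in ts *.
pose X : R := n%:R / l%:R; pose q := Num.sqrt X.
have nX : n%:R = l%:R * X by rewrite /X mulrC divfK // gt_eqF.
have X_geL : L ^+ 2 <= X.
  by rewrite /X ler_pdivlMr // mulrC -ler_pdivlMr // exprn_gt0 //; lra.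
have X_gt0 : 0 < X by rewrite divr_gt0.
have qX : q ^+ 2 = X by rewrite sqr_sqrtr // ltW.
have q_geL : L <= q by rewrite -[L]ger0_norm -?sqrtr_sqr ?ler_sqrt //; lra.
have q_ge1 : 1 <= q by lra.
pose Y := X ^+ r / q.
have powE : X `^ (k%:R / 2 - 1) = Y.
  rewrite /Y /q -powR_mulrn ?ltW // -powR12_sqrt ?ltW // -powRB ?(gt_eqF X_gt0) ?implybT //.
  by congr (_ `^ _); rewrite [in LHS]kE -addn1 natrD -muln2 natrM; lra.
pose L1 := L `^ (k.+1%:R^-1).
have L1E : L1 ^+ k.+1 = L.
  by rewrite -powR_mulrn ?powR_ge0 // -powRrM mulVf ?powRr1 ?pnatr_eq0 //; lra.
have L1_ge1 : 1 <= L1.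
  rewrite leNgt; apply/negP => L1_lt1.
  by have := exprn_ilt1 k.+1 (powR_ge0 _ _) L1_lt1; rewrite L1E ltNge L_ge1.
have Y_ge1 : 1 <= Y.
  rewrite ler_pdivlMr ?mul1r; last by lra.
  apply: (@le_trans _ _ X); first by rewrite -qX; nra.
  rewrite -[X in X <= _]expr1 ler_weXn2l //; nra.
have YE : X * Y ^+ k.+1 = X ^+ (r * k).
  have -> : Y ^+ k.+1 = X ^+ (r * k.+1) / X ^+ r.+1.
    by rewrite /Y expr_div_n -exprM; congr (_ / _); rewrite k1E exprM qX.
  rewrite mulnS addnC exprD exprS.
  have Xr : X ^+ r != 0 by rewrite expf_neq0 // gt_eqF.
  by field; rewrite Xr gt_eqF.
move: Hbig; rewrite -/X powE -/L1 => Hbig.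
set C := (odd_constant k)%:R in Hbig; set m := #|H|%:R in Hbig.
set K := local_constant k 4.
have C_ge : 16 + (24 * k * K ^ 2)%:R * T + (16 * K ^ k)%:R * T = C.
  by rewrite /C /odd_constant -/K 2!natrD 2![(_ * (4 * k * k + 2))%:R]natrM.
have T0 : 0 <= T by rewrite ler0n.
have C1 : (24 * k * K ^ 2)%:R * T <= C.
  have : 0 <= (16 * K ^ k)%:R * T by rewrite mulr_ge0 ?ler0n.
  by lra.
have C2 : (16 * K ^ k)%:R * T <= C.
  have : 0 <= (24 * k * K ^ 2)%:R * T by rewrite mulr_ge0 ?ler0n.
  by lra.
have C16 : 16 <= C.
  have h1 : 0 <= (24 * k * K ^ 2)%:R * T by rewrite mulr_ge0 ?ler0n.
  have h2 : 0 <= (16 * K ^ k)%:R * T by rewrite mulr_ge0 ?ler0n.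
  by lra.
have C0 : 0 <= C by lra.
have lL0 : 0 <= l%:R * L by rewrite mulr_ge0 ?ler0n //; lra.
have YL1 : 1 <= Y * L1 by nra.
have m_ge : C * n%:R * (Y * L1) <= m by rewrite mulrA.
have [||||||||S SH cS] := @odd_uniform_even_cover V H r l t; rewrite -?kE ?Vn //.
- exact: steps_gt0.
- exact: steps_large.
- rewrite -/K -(ler_nat R) [X in _ <= X]natrM -/m natrX.
  apply: (@le_trans _ _ (C * n%:R * (Y * L1) * l%:R ^+ r)); last first.
    by rewrite ler_wpM2r // exprn_ge0 // ltW.
  apply: (@le_trans _ _ (C * (l%:R * L) * n%:R ^+ r)).
    apply: (@le_trans _ _ ((24 * k * K ^ 2)%:R * (T * (l%:R * L)) * n%:R ^+ r)).
      rewrite (_ : (2 * k * _)%N = (24 * k * K ^ 2 * t * n ^ r)%N); last first.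
        by clear; generalize (K ^ 2)%N (n ^ r)%N; lia.
      rewrite natrM natrX ler_wpM2r ?exprn_ge0 ?ler0n // natrM.
      by rewrite ler_wpM2l ?ler0n.
    by rewrite ler_wpM2r ?exprn_ge0 ?ler0n // mulrA ler_wpM2r.
  have -> : C * n%:R * (Y * L1) * l%:R ^+ r = C * (l%:R * (q * L1)) * n%:R ^+ r.
    have nr : n%:R ^+ r = l%:R ^+ r * X ^+ r :> R by rewrite nX exprMn.
    have q0 : q != 0 by rewrite gt_eqF //; lra.
    by rewrite nr nX /Y; move: (X ^+ r) (l%:R ^+ r) => Z W; rewrite -qX; field.
  rewrite ler_wpM2r ?exprn_ge0 ?ler0n // ler_wpM2l // ler_wpM2l ?ler0n //.
  by nra.
- rewrite -/K -(ler_nat R) [X in _ <= X]natrM -/m [X in _ <= _ * X]natrM.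
  rewrite [X in _ <= _ * (X * _)]natrX [X in _ <= _ * (_ * X)]natrX.
  set d := (#|H| %/ (8 * n))%N.
  have m16 : 16 * n%:R <= m.
    apply: le_trans m_ge; rewrite -[X in X <= _]mulr1 ler_pM //; first by lra.
    by rewrite ler_wpM2r // ltW.
  (* As [d > 0], rounding loses at most a factor 2, and [16 <= C] absorbs the resulting [16 n]. *)
  have d_ge : Y * L1 <= d%:R.
    have n8 : (0 < 8 * n)%N by rewrite muln_gt0; apply: ltnW.
    have d_gt0 : (0 < d)%N.
      rewrite divn_gt0 // -(ler_nat R) natrM; apply: le_trans m16.
      by rewrite ler_wpM2r ?ler_nat // ltW.
    have : (#|H| <= 16 * n * d)%N.
      have := ltn_ceil #|H| n8; rewrite -/d => /ltnW h; apply: leq_trans h _.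
      by move: d_gt0; clear; nia.
    rewrite -(ler_nat R) -/m !natrM => h.
    have n16 : (0 : R) < 16 * n%:R by rewrite mulr_gt0.
    rewrite -(ler_pM2l n16); apply: le_trans h; apply: le_trans m_ge.
    by rewrite ler_wpM2r ?ler_wpM2r //; lra.
  apply: (@le_trans _ _ (C * n%:R * (Y * L1) * ((Y * L1) ^+ k * l%:R ^+ (r * k)))); last first.
    have YL0 : 0 <= Y * L1 by lra.
    apply: ler_pM => //.
    - by apply: mulr_ge0 => //; apply: mulr_ge0 => //; apply: ler0n.
    - by rewrite mulr_ge0 ?exprn_ge0 ?ler0n.
    - by rewrite ler_wpM2r ?exprn_ge0 ?ler0n // lerXn2r ?nnegrE ?ler0n.
  have -> : C * n%:R * (Y * L1) * ((Y * L1) ^+ k * l%:R ^+ (r * k)) =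
      C * (l%:R * L) * n%:R ^+ (r * k).
    have nE : n%:R ^+ (r * k) = l%:R ^+ (r * k) * (X * Y ^+ k.+1) :> R.
      by rewrite YE nX exprMn.
    rewrite nE nX -[in RHS]L1E [Y ^+ k.+1]exprS [L1 ^+ k.+1]exprS exprMn.
    by ring.
  apply: (@le_trans _ _ ((16 * K ^ k)%:R * (T * (l%:R * L)) * n%:R ^+ (r * k))).
    rewrite (_ : (16 * t * _)%N = (16 * K ^ k * t * n ^ (r * k))%N); last first.
      by clear; generalize (K ^ k)%N (n ^ (r * k))%N; lia.
    rewrite natrM natrX ler_wpM2r ?exprn_ge0 ?ler0n // natrM.
    by rewrite ler_wpM2l ?ler0n.
  by rewrite ler_wpM2r ?exprn_ge0 ?ler0n // mulrA ler_wpM2r.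
rewrite -kE in cS; exists S => //; apply: (@le_trans _ _ (2 * k.+1 * t)%:R); first by rewrite ler_nat.
by rewrite natrM ler_wpM2l ?ler0n.
Qed.

End Reals.

(** The conditions [1 < k] and [l <= n] exclude degenerate cases: distinct singletons have no even
    cover, and for even [k > 2] and [l] far above [n] the threshold falls below one hyperedge. *)
Theorem theorem1p1 (R : realType) (k : nat) (k_gt0 : (0 < k)%N) :
  exists C A : R, [/\ 0 < C, 0 < A &
    exists N : nat, forall n : nat, (N <= n)%N -> forall l : nat, (0 < l)%N ->
      (~~ odd k -> (l <= n)%N ->
        forall (V : finType) (H : {set {set V}}),
          #|V| = n -> uniform_hypergraph k H ->
          C * n%:R * (n%:R / l%:R) `^ (k%:R / 2 - 1) * log2 n%:R <= #|H|%:R ->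
          exists2 S : {set {set V}}, even_cover H S &
            #|S|%:R <= A * l%:R * log2 (n%:R : R))
      /\
      (odd k -> (1 < k)%N -> l%:R <= n%:R / log2 (n%:R : R) ^+ 2 ->
        forall (V : finType) (H : {set {set V}}),
          #|V| = n -> uniform_hypergraph k H ->
          C * n%:R * (n%:R / l%:R) `^ (k%:R / 2 - 1)
            * log2 n%:R `^ (k.+1%:R^-1) <= #|H|%:R ->
          exists2 S : {set {set V}}, even_cover H S &
            #|S|%:R <= A * l%:R * log2 (n%:R : R))].
Proof.
pose Ce : R := (even_constant k)%:R; pose Co : R := (odd_constant k)%:R.
pose M : R := (8 * k)%:R `^ k%:R; pose T : R := (4 * k * k + 2)%:R.
have k_ge1 : (1 : R) <= k%:R by rewrite ler1n.
have Ce0 : 0 <= Ce by rewrite ler0n.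
have Co16 : 16 <= Co by rewrite ler_nat /odd_constant -addnA leq_addr.
have M1 : 1 <= M.
  rewrite -[X in X <= _](powRr0 (8 * k)%:R) ler_powR ?ler0n // ler1n; lia.
have T2 : 2 <= T by rewrite ler_nat leq_addl.
(* [M] pays for the reduction of [l] in the even case; both constants are sums that cover the two
   parities. *)
exists (Ce * M + Co), ((4 + (2 * k.+1)%:R) * T).
have CeM : 0 <= Ce * M by rewrite mulr_ge0 //; lra.
split; [by lra | by rewrite mulr_gt0 ?ltr_wpDr ?ler0n //; lra |].
(* From here on [log n >= 4k], which turns [l <= n / log^2 n] into [4kl <= n]. *)
exists (2 ^ (4 * k))%N => n Nn l l_gt0.
have L_ge : (4 * k)%:R <= log2 (n%:R : R) by apply: log2_ge.
have n8k : (8 * k <= n)%N.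
  apply: leq_trans Nn; apply: (@leq_trans (2 ^ 3 * 2 ^ k)).
    by rewrite leq_mul // ltnW // ltn_expl.
  by rewrite -expnD leq_exp2l //; lia.
have n_gt1 : (1 < n)%N by apply: leq_trans n8k; lia.
set L := log2 (n%:R : R) in L_ge *.
have L_ge4 : 4 <= L.
  by apply: le_trans L_ge; rewrite ler_nat; lia.
have n0 : (0 : R) < n%:R by rewrite ltr0n; apply: ltnW.
have L0 : 0 <= L by lra.
have T0 : 0 <= T by lra.
have lL0 : 0 <= l%:R * L by rewrite mulr_ge0 ?ler0n.
have k1 : 0 <= (2 * k.+1)%:R :> R by rewrite ler0n.
split.
  move=> ek ln V H Vn Hk Hbig.
  have e0 : 0 <= k%:R / 2 - 1 :> R.
    have : 2 <= k%:R :> R by rewrite ler_nat; case: (k) ek k_gt0 => // -[].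
    by lra.
  have [l' [l'_gt0 l'n l'l pow_le]] : exists l' : nat, [/\ (0 < l')%N, (4 * k * l' <= n)%N,
      (l' <= l)%N & (n%:R / l'%:R) `^ (k%:R / 2 - 1) <= M * (n%:R / l%:R) `^ (k%:R / 2 - 1) :> R].
    have [kln|kln] := leqP (4 * k * l) n.
      by exists l; split=> //; rewrite ler_peMl ?powR_ge0.
    have [q_gt0 q1 q2 q3] := reduced_level k_gt0 n8k kln.
    exists (n %/ (4 * k))%N; split=> //.
    have pow1 : 1 <= (n%:R / l%:R) `^ (k%:R / 2 - 1) :> R.
      rewrite -[X in X <= _](powRr0 (n%:R / l%:R)) ler_powR //.
      by rewrite ler_pdivlMr ?ltr0n // mul1r ler_nat.
    apply: (@le_trans _ _ M); last by rewrite ler_peMr //; lra.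
    apply: (@le_trans _ _ ((8 * k)%:R `^ (k%:R / 2 - 1))).
      apply: ge0_ler_powR; rewrite ?nnegrE ?divr_ge0 ?ler0n //.
      by rewrite ler_pdivrMr ?ltr0n // -natrM ler_nat.
    by apply: ler_powR; [rewrite ler1n muln_gt0|lra].
  have [|S SH cS] := @even_case R k n l' V H k_gt0 ek n_gt1 l'_gt0 l'n Vn Hk.
    apply: le_trans Hbig; rewrite -/L ler_wpM2r //.
    rewrite -/Ce mulrAC [X in _ <= X]mulrAC ler_wpM2r ?ler0n //.
    apply: (@le_trans _ _ (Ce * (M * (n%:R / l%:R) `^ (k%:R / 2 - 1)))).
      by rewrite ler_wpM2l.
    by rewrite mulrA ler_wpM2r ?powR_ge0 //; lra.
  exists S => //; apply: le_trans cS _; rewrite -/T -/L.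
  rewrite (_ : _ * T * l%:R * L = 4 * (T * (l%:R * L)) + (2 * k.+1)%:R * (T * (l%:R * L)));
    last by ring.
  rewrite -[X in X <= _]addr0; apply: lerD; last by do 2![apply: mulr_ge0 => //].
  by rewrite ler_wpM2l // ler_wpM2l // ler_wpM2r // ler_nat.
move=> ok k_gt1 ln V H Vn Hk Hbig.
have kln : (4 * k * l <= n)%N.
  rewrite -(ler_nat R); apply: (@le_trans _ _ (L ^+ 2 * l%:R)).
    by rewrite natrM ler_wpM2r ?ler0n //; nra.
  by rewrite mulrC -ler_pdivlMr // exprn_gt0 //; lra.
have [|S SH cS] := @odd_case R k n l V H ok k_gt1 n_gt1 l_gt0 kln Vn ln Hk.
  apply: le_trans Hbig; rewrite -/L ler_wpM2r ?powR_ge0 // ler_wpM2r ?powR_ge0 //.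
  by rewrite ler_wpM2r ?ler0n // -/Co; lra.
exists S => //; apply: le_trans cS _; rewrite -/T -/L.
rewrite (_ : _ * T * l%:R * L = 4 * (T * (l%:R * L)) + (2 * k.+1)%:R * (T * (l%:R * L)));
  last by ring.
by rewrite -[X in X <= _]add0r; apply: lerD => //; do 2![apply: mulr_ge0 => //].
Qed.
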